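(* Let $n\geq 1$ be an integer, let $0<s\leq a\leq 1$, and let $f\in H^s(\mathbb{R}^n)$. Let $\{t_k\}_{k=1}^\infty$ be a sequence of nonnegative real numbers converging to $0$ with $\sum_{k=1}^{\infty}t_k^{\frac{2s}{a}}<\infty$. Then $$\lim_{k\rightarrow\infty}(2\pi)^{-n}S_{t_k,a}f(x)=f(x)$$ for almost every $x\in\mathbb{R}^n$.
   Context: Fourier transform convention: $\widehat{f}(\xi)=\int_{\mathbb{R}^n}e^{-i\xi\cdot x}f(x)\,dx$. The Sobolev space $H^s(\mathbb{R}^n)$ is the set of tempered distributions $f$ with $\|f\|_{H^s(\mathbb{R}^n)}=\left(\int_{\mathbb{R}^n}(1+|\xi|^2)^s|\widehat f(\xi)|^2\,d\xi\right)^{1/2}<\infty$. For $t\geq0$ and $a>0$, $$S_{t,a}f(x)=\int_{\mathbb{R}^n}e^{ix\cdot\xi}e^{it|\xi|^a}\widehat f(\xi)\,d\xi,\qquad x\in\mathbb{R}^n,$$ where for general $f\in H^s(\mathbb{R}^n)$, $s\ge 0$, the integral is understood in the $L^2$ (Plancherel) sense, i.e. $(2\pi)^{-n}S_{t,a}f$ is the $L^2$ function whose Fourier transform is $e^{it|\xi|^a}\widehat f(\xi)$. *)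

(* Defs.v *)
From HB Require Import structures.
From mathcomp Require Import all_boot all_order all_algebra.
From mathcomp Require Import all_classical all_reals all_analysis.
From mathcomp.real_closed Require Import complex.

Set Implicit Arguments.
Unset Strict Implicit.
Unset Printing Implicit Defensive.

Import Order.TTheory GRing.Theory Num.Theory.
Import numFieldNormedType.Exports.

Local Open Scope classical_set_scope.
Local Open Scope ring_scope.

(* The sigma-algebra generated by the coordinates, i.e. the Borel one. *)
Definition rV_display : measure_display -> measure_display.
Proof. exact. Qed.

Section rV_measurable.
Variables (R : realType) (n : nat).

Let coord (i : 'I_n) (x : 'rV[R]_n) : R := x 0 i.

Let rV_set0 : g_sigma_preimage coord set0.
Proof. exact: sigma_algebra0. Qed.

Let rV_setC A : g_sigma_preimage coord A -> g_sigma_preimage coord (~` A).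
Proof. exact: sigma_algebraC. Qed.

Let rV_bigcup (F : _^nat) : (forall i, g_sigma_preimage coord (F i)) ->
  g_sigma_preimage coord (\bigcup_i (F i)).
Proof. exact: sigma_algebra_bigcup. Qed.

HB.instance Definition _ := @isMeasurable.Build (rV_display default_measure_display)
  'rV[R]_n (g_sigma_preimage coord) rV_set0 rV_setC rV_bigcup.

Lemma measurable_coord (i : 'I_n) :
  measurable_fun [set: 'rV[R]_n] (fun x : 'rV[R]_n => x 0 i).
Proof.
move=> _ Y mY; rewrite setTI; apply: sub_sigma_algebra => /=.
rewrite -bigcup_seq/=; exists i => /=; first by rewrite mem_index_enum.
by exists Y => //; rewrite setTI.
Qed.

Lemma measurable_fun_coordP d (T : measurableType d) (f : T -> 'rV[R]_n) :
  measurable_fun [set: T] f <->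
  forall i, measurable_fun [set: T] (fun x => f x 0 i).
Proof.
split=> [mf i|mf]; first exact: (measurableT_comp (measurable_coord i) mf).
move=> _ A mA; rewrite setTI.
suff : measurable `<=` [set B : set 'rV[R]_n | measurable (f @^-1` B)] by apply.
apply: smallest_sub.
  split => /=; first by rewrite preimage_set0.
  - by move=> B mB; rewrite setTD preimage_setC; exact: measurableC.
  - by move=> F mF; rewrite preimage_bigcup; exact: bigcup_measurable.
rewrite -bigcup_seq => B [i /= _ [C mC <-]] /=.
by rewrite setTI; have := mf i measurableT C mC; rewrite setTI.
Qed.

End rV_measurable.

Section lebesgue_rV.
Variable R : realType.

Definition consrV n (p : R * 'rV[R]_n) : 'rV[R]_n.+1 :=
  row_mx (\row_(_ < 1) p.1) p.2 : 'rV[R]_(1 + n).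

(* Lebesgue measure on R^n: iterated product of the one on R, transported
   along R * R^n -> R^(n+1); R^0 is a point of mass 1. *)
Fixpoint lebesgue_rV (n : nat) : set 'rV[R]_n -> \bar R :=
  match n with
  | 0 => @dirac _ 'rV[R]_0 0 R
  | n'.+1 => pushforward (product_measure1 (@lebesgue_measure R) (@lebesgue_rV n')) (@consrV n')
  end.

Lemma measurable_consrV n : measurable_fun setT (@consrV n).
Proof.
apply/measurable_fun_coordP => i; rewrite /consrV.
case: (@split_ordP 1 n i) => j ->.
  rewrite [X in measurable_fun _ X](_ : _ = fst); first exact: measurable_fst.
  by apply/funext => p; rewrite [LHS]row_mxEl mxE.
rewrite [X in measurable_fun _ X](_ : _ = fun p : R * 'rV[R]_n => p.2 0 j).
  exact: (measurableT_comp (measurable_coord j) measurable_snd).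
by apply/funext => p; rewrite [LHS]row_mxEr.
Qed.

Let uncons n (x : 'rV[R]_n.+1) : R * 'rV[R]_n :=
  (x 0 ord0, \row_j x 0 (lift ord0 j)).

Let measurable_uncons n : measurable_fun setT (@uncons n).
Proof.
apply/measurable_fun_pairP; split => /=.
  exact: measurable_coord.
apply/measurable_fun_coordP => i.
rewrite [X in measurable_fun _ X](_ : _ = fun x : 'rV[R]_n.+1 => x 0 (lift ord0 i)).
  exact: measurable_coord.
by apply/funext => x; rewrite mxE.
Qed.

Let consrVK n : cancel (@consrV n) (@uncons n).
Proof.
move=> [a y]; congr pair.
  rewrite (_ : ord0 = lshift n (ord0 : 'I_1)); last exact/val_inj.
  by rewrite [LHS]row_mxEl mxE.
apply/rowP => j; rewrite mxE.
rewrite (_ : lift ord0 j = rshift 1 j); last exact/val_inj.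
exact: row_mxEr.
Qed.

Let lebesgue_rV_bundle n : exists m : {sigma_finite_measure set 'rV[R]_n -> \bar R},
  (m : set _ -> \bar R) = @lebesgue_rV n.
Proof.
elim: n => [|n [m IH]].
  by exists (@dirac _ 'rV[R]_0 0 R).
rewrite /= -IH.
pose mu := @lebesgue_measure R.
pose pr := (mu \x m)%E.
have mc := @measurable_consrV n.
pose pf0 : {measure set 'rV[R]_n.+1 -> \bar R} :=
  pushforward pr (@consrV n).
pose pf := pf0 mc.
have sf : sigma_finite setT pf.
  have [F [UF Foo]] : sigma_finite setT pr.
    have /sigma_finiteP[F [TF ndF Foo]] := sigma_finiteT mu.
    have /sigma_finiteP[G [TG ndG Goo]] := sigma_finiteT m.
    exists (fun n => F n `*` G n).
     rewrite -setXTT TF TG predeqE => -[x y]; split.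
        move=> [/= [k _ Fnx] [l _ Gky]]; exists (maxn k l) => //; split.
        - by move: x Fnx; exact/subsetPset/ndF/leq_maxl.
        - by move: y Gky; exact/subsetPset/ndG/leq_maxr.
      by move=> [k _ []/= ? ?]; split; exists k.
    move=> k; have [? ?] := Foo k; have [? ?] := Goo k.
    split; first exact: measurableX.
    by rewrite /pr product_measure1E// lte_mul_pinfty// ge0_fin_numE.
  exists (fun k => @uncons n @^-1` F k).
    by rewrite -preimage_bigcup -UF preimage_setT.
  move=> k; have [mF Fk] := Foo k; split.
    by rewrite -[X in measurable X]setTI; exact: measurable_uncons.
  have E : @consrV n @^-1` (@uncons n @^-1` F k) = F k.
    by apply/funext => p; rewrite /preimage/= consrVK.
  by rewrite -E in Fk.
pose H1 := isMeasure.Build _ _ _ (pf : set _ -> \bar R)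
  (measure0 pf) (measure_ge0 pf) (@measure_semi_sigma_additive _ _ _ pf).
pose m1 : {measure set 'rV[R]_n.+1 -> \bar R} := HB.pack (pf : set _ -> \bar R) H1.
pose H2 := Measure_isSigmaFinite.Build _ _ _ (m1 : set _ -> \bar R) sf.
pose pf' : {sigma_finite_measure set 'rV[R]_n.+1 -> \bar R} :=
  HB.pack (pf : set _ -> \bar R) H1 H2.
by exists pf'.
Qed.

Section lebesgue_rV_instance.
Variable n : nat.

Let leb0 : @lebesgue_rV n set0 = 0%E.
Proof. by have [m <-] := lebesgue_rV_bundle n; exact: measure0. Qed.

Let leb_ge0 A : (0 <= @lebesgue_rV n A)%E.
Proof. by have [m <-] := lebesgue_rV_bundle n; exact: measure_ge0. Qed.

Let leb_sigma_additive : semi_sigma_additive (@lebesgue_rV n).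
Proof.
by have [m <-] := lebesgue_rV_bundle n; exact: measure_semi_sigma_additive.
Qed.

HB.instance Definition _ := isMeasure.Build _ _ _ (@lebesgue_rV n)
  leb0 leb_ge0 leb_sigma_additive.

Let leb_sigma_finite : sigma_finite setT (@lebesgue_rV n).
Proof. by have [m <-] := lebesgue_rV_bundle n; exact: sigma_finiteT. Qed.

HB.instance Definition _ := Measure_isSigmaFinite.Build _ _ _ (@lebesgue_rV n)
  leb_sigma_finite.

End lebesgue_rV_instance.

Lemma lebesgue_rV_box n (A : 'I_n -> set R) : (forall i, measurable (A i)) ->
  @lebesgue_rV n [set x | forall i, A i (x 0 i)] =
  (\prod_(i < n) @lebesgue_measure R (A i))%E.
Proof.
elim: n A => [|n IH] A mA.
  by rewrite big_ord0 /= diracE mem_set// => -[].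
rewrite big_ord_recl -IH//.
have mB : measurable [set x : 'rV[R]_n | forall i, A (lift ord0 i) (x 0 i)].
  rewrite [X in measurable X](_ : _ =
      \bigcap_(i in [set: 'I_n]) (fun x : 'rV[R]_n => x 0 i) @^-1` A (lift ord0 i)).
    apply: fin_bigcap_measurable => // i _.
    by rewrite -[X in measurable X]setTI; exact: measurable_coord.
  by apply/seteqP; split => x /= h => [i _|i]; exact: h.
rewrite -(@product_measure1E _ _ _ _ _ (@lebesgue_measure R))//=; last exact: mA.
rewrite /pushforward; congr (_ _).
apply/seteqP; split => -[a y]/=.
  move=> h; split.
    have := h ord0; have := consrVK (a, y); rewrite /uncons => -[-> _]; exact.
  move=> i; have := h (lift ord0 i); have := consrVK (a, y).
  by rewrite /uncons => -[_ /rowP/(_ i)]; rewrite mxE => ->.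
move=> [Aa Ay] i; have := consrVK (a, y); rewrite /uncons => -[e1 e2].
case: (unliftP ord0 i) => [j ->|->]; last by rewrite e1.
by move/rowP: e2 => /(_ j); rewrite mxE => ->.
Qed.

End lebesgue_rV.

Section complex_functions.
Variables (R : realType) (n : nat).
Local Notation V := 'rV[R]_n.
Local Notation leb := (@lebesgue_rV R n).

Definition dot (x y : V) : R := \sum_(i < n) x 0 i * y 0 i.

(* Euclidean norm; the library norm `|x| on 'rV[R]_n is the sup norm. *)
Definition enorm (x : V) : R := Num.sqrt (dot x x).

Definition expi (r : R) : R[i] := (cos r +i* sin r)%C.

Definition cmeasurable (f : V -> R[i]) : Prop :=
  measurable_fun setT (fun x => complex.Re (f x)) /\
  measurable_fun setT (fun x => complex.Im (f x)).

Definition cintegrable (f : V -> R[i]) : Prop :=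
  leb.-integrable setT (fun x => (complex.Re (f x))%:E) /\
  leb.-integrable setT (fun x => (complex.Im (f x))%:E).

Definition cintegral (f : V -> R[i]) : R[i] :=
  (Rintegral leb setT (fun x => complex.Re (f x)) +i*
   Rintegral leb setT (fun x => complex.Im (f x)))%C.

Definition memL2 (f : V -> R[i]) : Prop :=
  cmeasurable f /\ (\int[leb]_x ((Normc.normc (f x)) ^+ 2)%:E < +oo)%E.

Definition fourier (f : V -> R[i]) : V -> R[i] :=
  fun xi => cintegral (fun x => expi (- dot xi x) * f x).

Definition partial (i : 'I_n) (g : V -> R) : V -> R :=
  fun x => 'D_(delta_mx 0 i) g x.

(* For s = [:: i1; ...; ik], the mixed derivative d_{i1} ... d_{ik} g. *)
Definition partials (s : seq 'I_n) (g : V -> R) : V -> R := foldr partial g s.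

Definition smooth (g : V -> R) : Prop :=
  forall s, continuous (partials s g) /\
    forall (x : V) i, derivable (partials s g) x (delta_mx 0 i).

Definition cpartials (s : seq 'I_n) (f : V -> R[i]) : V -> R[i] :=
  fun x => (partials s (fun y => complex.Re (f y)) x +i*
            partials s (fun y => complex.Im (f y)) x)%C.

(* |x^al * d_s f(x)| *)
Definition weighted (al : 'I_n -> nat) (s : seq 'I_n) (f : V -> R[i]) : V -> R :=
  fun x => Normc.normc ((\prod_(i < n) x 0 i ^+ al i)%:C%C * cpartials s f x).

Definition schwartz (f : V -> R[i]) : Prop :=
  [/\ smooth (fun x => complex.Re (f x)), smooth (fun x => complex.Im (f x)) &
    forall al s, exists M, forall x, weighted al s f x <= M].

Definition seminorm (al : 'I_n -> nat) (s : seq 'I_n) (f : V -> R[i]) : R :=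
  sup (range (weighted al s f)).

(* A distribution is a functional whose values matter on Schwartz functions
   only. *)
Definition tempered (T : (V -> R[i]) -> R[i]) : Prop :=
  (forall (c : R[i]) f g, schwartz f -> schwartz g ->
     T (fun x => c * f x + g x) = c * T f + T g) /\
  exists (m : nat) (C : R), forall f, schwartz f ->
    Normc.normc (T f) <=
    C * \sum_(al : {ffun 'I_n -> 'I_m.+1}) \sum_(k < m.+1)
          \sum_(s : k.-tuple 'I_n) seminorm (fun i => al i) s f.

(* The distribution T is (integration against) the function f. *)
Definition represents (T : (V -> R[i]) -> R[i]) (f : V -> R[i]) : Prop :=
  cmeasurable f /\
  forall phi, schwartz phi ->
    cintegrable (fun x => f x * phi x) /\
    T phi = cintegral (fun x => f x * phi x).

Definition regular (f : V -> R[i]) : (V -> R[i]) -> R[i] :=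
  fun phi => cintegral (fun x => f x * phi x).

(* Duality with the convention of [fourier]: if T is integration against an
   integrable f, this is integration against [fourier f]. *)
Definition fourier_distr (T : (V -> R[i]) -> R[i]) : (V -> R[i]) -> R[i] :=
  fun phi => T (fourier phi).

(* The H^s norm of the distribution whose Fourier transform is the function F. *)
Definition sobolev_norm (s : R) (F : V -> R[i]) : \bar R :=
  ((\int[leb]_xi
      ((1 + enorm xi ^+ 2) `^ s * Normc.normc (F xi) ^+ 2)%:E) `^ 2^-1)%E.

Definition sobolev (s : R) (T : (V -> R[i]) -> R[i]) : Prop :=
  tempered T /\
  exists2 F, represents (fourier_distr T) F & (sobolev_norm s F < +oo)%E.

(* u is (a version of) S_{t,a} T in the Plancherel sense: (2 pi)^(-n) u is the
   L^2 function whose Fourier transform is e^{i t |xi|^a} times that of T.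
   A relation, since u is only determined almost everywhere. *)
Definition is_S (t a : R) (T : (V -> R[i]) -> R[i]) (u : V -> R[i]) : Prop :=
  let v := fun x => ((2 * pi) ^- n)%:C%C * u x in
  memL2 v /\
  exists2 F, represents (fourier_distr T) F &
    represents (fourier_distr (regular v))
      (fun xi => expi (t * enorm xi `^ a) * F xi).

End complex_functions.

(* Main.v *)
Require Import Defs.
From HB Require Import structures.
From mathcomp Require Import all_boot all_order all_algebra.
From mathcomp Require Import all_classical all_reals all_analysis.
From mathcomp Require Import measurable_realfun.
From mathcomp.real_closed Require Import complex.
From mathcomp Require Import ring lra.

Import Order.TTheory GRing.Theory Num.Theory.
Import numFieldNormedType.Exports.

Local Open Scope classical_set_scope.
Local Open Scope ring_scope.

(* Put w = (2 pi)^-n S_t f - f, whose Fourier transform is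
   G = (e^{i t |xi|^a} - 1) F with F the Fourier transform of f. Since
   |e^{i r} - 1|^2 <= 4 r^(2s/a), Plancherel bounds the squared L^2 norm of w by
   a constant times t^(2s/a) times the squared H^s norm of f; summing over t_k,
   the series of |w_k|^2 is integrable, hence converges almost everywhere, and
   its terms tend to 0.

   Only the inequality |w|_2 <= (2 pi)^(-n/2) |G|_2 is needed, where w is merely
   integrable against Schwartz functions. Testing against combinations of
   translates of one fixed Gaussian turns the right-hand side into trigonometric
   polynomials times that Gaussian, and both Gram matrices are explicit, so
     2 int u p g - int p^2 g^2 <= (2 pi)^-n |G|_2^2
   for u = Re w or Im w, g the Gaussian, and p any real trigonometric polynomial.
   This inequality is stable under bounded pointwise limits of p, and bounded
   pointwise limits of trigonometric polynomials exhaust the bounded measurable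
   functions, so p may be taken to be a truncation of u / g. *)

(** The obstacle is that [f] is given only as a function integrable against Schwartz functions, so
    the square integrability of w has to come out of the pairing itself. Translated Gaussians serve
    as tests because their Fourier transforms are one fixed Gaussian times characters: both sides of
    the duality are then explicit finite sums. The quadratic form comes from u^2 >= u^2 - (u - p
    g)^2 = 2 u p g - p^2 g^2, with equality at p = u / g. On the other side, 2 Re (e G Phi) <= e^2
    |G|^2 + |Phi|^2 with e = (2 pi)^(-n/2), and the integral of |Phi|^2 cancels that of p^2 g^2. The
    multiplier bound interpolates: |e^{i r} - 1|^2 is at most r^2 and at most 4, and s <= a makes
    the exponent 2s/a at most 2. With r = t |xi|^a the power r^(2s/a) contributes |xi|^(2s), which
    the Sobolev weight dominates. A distribution determines its Fourier transform F only almost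
    everywhere, and each S_t f comes with its own version of F; the same inequality with G = 0
    identifies these versions. *)

Section real_integrable.
Set Implicit Arguments.
Unset Strict Implicit.
Context d (T : measurableType d) (R : realType) (mu : {measure set T -> \bar R}).
Implicit Types f g : T -> R.
Local Notation integ f := (mu.-integrable setT (fun x => (f x)%:E)).

Lemma Rintegrable_measurable f : integ f -> measurable_fun setT f.
Proof. by move=> /integrableP[/measurable_EFinP]. Qed.

Lemma RintegrableZ r f : integ f -> integ (fun x => r * f x).
Proof. by move=> /(integrableZl measurableT r). Qed.

Lemma RintegrableD f g : integ f -> integ g -> integ (fun x => f x + g x).
Proof. by move=> fi gi; have := integrableD measurableT fi gi. Qed.

Lemma RintegrableB f g : integ f -> integ g -> integ (fun x => f x - g x).
Proof. by move=> fi gi; have := integrableB measurableT fi gi. Qed.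

Lemma Rintegrable_le f g : measurable_fun setT f ->
  (forall x, `|f x| <= g x) -> integ g -> integ f.
Proof.
move=> mf fg gi; apply: le_integrable gi => //; first exact/measurable_EFinP.
by move=> x _ /=; rewrite lee_fin (le_trans (fg x))// ler_norm.
Qed.

Lemma Rintegrable_sum (I : Type) (s : seq I) (F : I -> T -> R) :
  (forall i, integ (F i)) -> integ (fun x => \sum_(i <- s) F i x).
Proof.
move=> Fi; elim: s => [|i s IH].
  by under eq_fun do rewrite big_nil; exact: integrable0.
by under eq_fun do rewrite big_cons; exact: RintegrableD.
Qed.

Lemma Rintegral_sum (I : Type) (s : seq I) (F : I -> T -> R) :
  (forall i, integ (F i)) ->
  \int[mu]_x (\sum_(i <- s) F i x) = \sum_(i <- s) \int[mu]_x F i x.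
Proof.
move=> Fi; elim: s => [|i s IH].
  by under eq_Rintegral do rewrite big_nil; rewrite big_nil /Rintegral integral0.
under eq_Rintegral do rewrite big_cons.
rewrite big_cons -IH -RintegralD//; first exact: Fi.
exact: (Rintegrable_sum s Fi).
Qed.

End real_integrable.

(** * Gaussian integrals *)

Section gauss1.
Set Implicit Arguments.
Unset Strict Implicit.
Variable R : realType.
Local Notation mu := (@lebesgue_measure R).

Definition gauss1 (c b x : R) : R := expR (- (c * (x - b) ^+ 2)).

Lemma gauss1_ge0 c b x : 0 <= gauss1 c b x.
Proof. exact: expR_ge0. Qed.

Lemma gauss1_integral (c b : R) : 0 < c ->
  mu.-integrable setT (EFin \o gauss1 c b) /\
  \int[mu]_x gauss1 c b x = Num.sqrt (pi / c).
Proof.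
move=> c0.
(* The standard deviation for which the normal density is proportional to [gauss1 c b]. *)
pose s : R := Num.sqrt (2 * c)^-1.
have s2 : s ^+ 2 = (2 * c)^-1 by rewrite sqr_sqrtr// invr_ge0 mulr_ge0// ltW.
have s0 : s != 0.
  by apply/negP => /eqP s0; move: s2; rewrite s0 expr0n/= => /esym/eqP;
    rewrite invr_eq0 mulf_eq0 pnatr_eq0/= (gt_eqF c0).
have pE : normal_peak s = (Num.sqrt (pi / c))^-1.
  rewrite /normal_peak s2; congr (Num.sqrt _)^-1.
  by rewrite -mulr_natl; field; rewrite gt_eqF.
have sp0 : Num.sqrt (pi / c) != 0.
  by rewrite gt_eqF// sqrtr_gt0 divr_gt0// pi_gt0.
have gE : gauss1 c b = fun x => Num.sqrt (pi / c) * normal_pdf b s x.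
  apply/funext => x; rewrite normal_pdfE// pE mulrA divff// mul1r.
  rewrite /normal_fun /gauss1 s2; congr expR.
  by rewrite -mulr_natl; field; rewrite gt_eqF.
have ip := @integrable_normal_pdf R b s.
split.
  rewrite gE; rewrite (_ : EFin \o _ = fun x => ((Num.sqrt (pi / c))%:E * (normal_pdf b s x)%:E)%E)//.
  exact: integrableZl.
rewrite gE RintegralZl//.
by rewrite /Rintegral integral_normal_pdf/= mulr1.
Qed.

(** Half of the exponent absorbs the linear factor, since |y| <= 1 + y^2 and 1 + c y^2 / 2 <= exp (c
    y^2 / 2). The integrability that follows is what dominates the derivative of the Fourier
    integral in the frequency. *)
Lemma gauss1_moment (c b x : R) : 0 < c ->
  `|x - b| * gauss1 c b x <= (1 + 2 / c) * gauss1 (c / 2) b x.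
Proof.
move=> c0; set y := x - b.
have -> : gauss1 c b x = gauss1 (c / 2) b x * gauss1 (c / 2) b x.
  rewrite /gauss1 -expRD; congr expR; rewrite -/y; by field.
rewrite mulrA ler_wpM2r ?expR_ge0//.
have h : 1 + c / 2 * y ^+ 2 <= expR (c / 2 * y ^+ 2) by exact: expR_ge1Dx.
rewrite /gauss1 -/y expRN.
have e0 : 0 < expR (c / 2 * y ^+ 2) by exact: expR_gt0.
rewrite ler_pdivrMr//; apply: le_trans (_ : (1 + 2 / c) * (1 + c / 2 * y ^+ 2) <= _); last first.
  by rewrite ler_wpM2l// addr_ge0// divr_ge0// ltW.
have -> : (1 + 2 / c) * (1 + c / 2 * y ^+ 2) = 1 + y ^+ 2 + (2 / c + c / 2 * y ^+ 2).
  by field; rewrite gt_eqF.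
have : 0 <= 2 / c + c / 2 * y ^+ 2.
  have c1 := ltW c0; apply: addr_ge0; first exact: divr_ge0.
  by apply: mulr_ge0; [exact: divr_ge0|exact: sqr_ge0].
have : `|y| <= 1 + y ^+ 2.
  rewrite -real_normK ?num_real//; have := normr_ge0 y; set z := `|y|; nra.
lra.
Qed.

Lemma measurable_gauss1 c b : measurable_fun setT (gauss1 c b).
Proof.
apply: measurableT_comp => //; apply: measurableT_comp => //.
apply: measurable_funM => //; apply: measurable_funX; exact: measurable_funB.
Qed.

Lemma is_derive_gauss1 c b x :
  is_derive x (1 : R) (gauss1 c b) (- (2 * c * (x - b)) * gauss1 c b x).
Proof.
have h : is_derive x (1 : R) (fun y => - (c * (y - b) ^+ 2)) (- (2 * c * (x - b))).
  apply: is_derive_eq; rewrite /GRing.scale/=.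
  by ring.
by apply: is_derive_eq (is_derive1_comp (is_derive_expR _) h) _; rewrite mulrC.
Qed.

Lemma is_derive1_continuous (f d : R -> R) :
  (forall x : R, is_derive x (1 : R) f (d x)) -> continuous f.
Proof.
move=> h x; apply: differentiable_continuous; apply/derivable1_diffP.
by have [] := h x.
Qed.

Lemma gauss1_moment_integrable c b : 0 < c ->
  mu.-integrable setT (fun x => (`|x - b| * gauss1 c b x)%:E).
Proof.
move=> c0.
have c20 : 0 < c / 2 by rewrite divr_gt0.
have [ig _] := gauss1_integral b c20.
have ig' := integrableZl measurableT (1 + 2 / c) ig.
apply: le_integrable ig' => //.
  apply/measurable_EFinP; apply: measurable_funM; last exact: measurable_gauss1.
  apply: measurableT_comp => //; exact: measurable_funB.
move=> x _ /=; rewrite lee_fin ger0_norm; last by rewrite mulr_ge0 ?expR_ge0.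
by rewrite (le_trans (gauss1_moment _ _ c0))// ler_norm.
Qed.

(** Integration by parts without boundary terms: the fundamental theorem of calculus on growing
    symmetric intervals, then dominated convergence with dominating function |d|. *)
Lemma integral_derivative0 (D d : R -> R) :
  (forall x : R, is_derive x (1 : R) D (d x)) -> continuous d ->
  mu.-integrable setT (EFin \o d) ->
  D x @[x --> +oo%R] --> 0 -> D x @[x --> -oo%R] --> 0 ->
  \int[mu]_x d x = 0.
Proof.
move=> Dd cd id Dy Dny.
(* The successor keeps the interval nondegenerate for k = 0. *)
pose A (k : nat) : set R := `[- k.+1%:R, k.+1%:R]%classic.
pose h (k : nat) (x : R) : \bar R := (d x * \1_(A k) x)%:E.
have md : measurable_fun setT d by move/integrableP: id => [/measurable_EFinP].
have hE k : (\int[mu]_x h k x = (D k.+1%:R)%:E - (D (- k.+1%:R))%:E)%E.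
  rewrite -(@continuous_FTC2 R d).
  - rewrite [RHS]integral_mkcond; apply: eq_integral => x _.
    rewrite /h /A patchE indicE.
    by case: (x \in _); rewrite ?mulr1 ?mulr0.
  - by rewrite (@lt_trans _ _ 0)// ?oppr_lt0 ltr0Sn.
  - exact: continuous_subspaceT.
  - have cD : continuous D.
      move=> x; apply: differentiable_continuous; apply/derivable1_diffP.
      by have [] := Dd x.
    split => [x _||]; first by have [] := Dd x.
      by apply: cvg_at_right_filter; exact: cD.
    by apply: cvg_at_left_filter; exact: cD.
  - by move=> x _; rewrite derive1E; have [] := Dd x.
have mh n : measurable_fun setT (h n).
  apply/measurable_EFinP; apply: measurable_funM; first exact: md.
  by apply: measurable_indic; exact: measurable_itv.
have H1 : measurable_fun setT (EFin \o d) by exact/measurable_EFinP.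
have H2 : {ae mu, forall x, setT x -> h ^~ x @ \oo --> (EFin \o d) x}.
  apply: aeW => x _; apply: cvg_near_cst.
  near=> k; rewrite /h /= indicE mem_set ?mulr1// /A /= in_itv/= -ler_norml.
  apply: le_trans (_ : k%:R <= _); last by rewrite ler_nat.
  near: k; exact: nbhs_infty_ger.
have H3 : mu.-integrable setT (fun x => `|(d x)%:E|%E) by exact: integrable_abse.
have H4 : {ae mu, forall x n, setT x -> (`|h n x| <= `|(d x)%:E|)%E}.
  apply: aeW => x n _; rewrite /h lee_fin normrM ler_piMr//.
  by rewrite indicE; case: (_ \in _); rewrite ?normr1 ?normr0.
have [_ _ L1] := @dominated_convergence _ _ _ mu setT measurableT h (EFin \o d)
  (fun x => `|(d x)%:E|%E) mh H1 H2 H3 H4.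
have kk : (k.+1%:R : R) @[k --> \oo] --> +oo%R.
  apply/cvgryPge => M; near=> k.
  apply: le_trans (_ : k%:R <= _); last by rewrite ler_nat.
  near: k; exact: nbhs_infty_ger.
have kk' : (- k.+1%:R : R) @[k --> \oo] --> -oo%R.
  apply/cvgrNyPle => M; near=> k; rewrite lerNl.
  apply: le_trans (_ : k%:R <= _); last by rewrite ler_nat.
  near: k; exact: nbhs_infty_ger.
have L2 : (\int[mu]_x h k x)%E @[k --> \oo] --> (0 - 0)%:E.
  under eq_fun do rewrite hE -EFinB.
  apply: cvg_EFin; first exact: nearW.
  apply: cvgB; first exact: (cvg_comp _ _ kk Dy).
  exact: (cvg_comp _ _ kk' Dny).
by rewrite /Rintegral -(cvg_lim _ L1)// (cvg_lim _ L2)//= subrr.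
Unshelve. all: end_near. Qed.


Lemma gauss1_cvg0 c b (u : R -> R) : 0 < c -> (forall x, `|u x| <= 1) ->
  u x * gauss1 c b x @[x --> +oo%R] --> 0 /\
  u x * gauss1 c b x @[x --> -oo%R] --> 0.
Proof.
move=> c0 u1.
have key (F : set_system R) : ProperFilter F ->
    (forall M, \forall x \near F, M <= `|x - b|) ->
    u x * gauss1 c b x @[x --> F] --> 0.
  move=> PF hF; apply/cvgr0Pnorm_le => e e0.
  near=> x; rewrite normrM [X in _ * X]ger0_norm ?expR_ge0//.
  apply: (@le_trans _ _ (gauss1 c b x)); first by rewrite ler_piMl ?expR_ge0.
  (* The summand 1 turns z >= w + 1 into z^2 >= w, so that c |x - b|^2 >= 1/e; then exp y >= 1 + y
     gives exp (c |x - b|^2) >= 1/e. *)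
  have h : e^-1 / c + 1 <= `|x - b| by near: x; exact: hF.
  have c1 : 0 < e^-1 / c by rewrite divr_gt0 ?invr_gt0.
  have ec : c * (e^-1 / c) = e^-1 by field; rewrite !gt_eqF.
  have : e^-1 / c <= `|x - b| ^+ 2 by move: h c1; set z := `|_|; set w := _ / c; nra.
  rewrite real_normK ?num_real// /gauss1 expRN => h2.
  rewrite -[leRHS]invrK lef_pV2 ?posrE ?invr_gt0 ?expR_gt0//.
  apply: le_trans (expR_ge1Dx _).
  rewrite -ec; have := ler_wpM2l (ltW c0) h2; lra.
split; apply: key => M.
  near=> x; apply: le_trans (ler_norm _).
  by rewrite lerBrDr; near: x; by apply: nbhs_pinfty_ge; rewrite num_real.
near=> x; rewrite distrC; apply: le_trans (ler_norm _).
by rewrite lerBrDl -lerBrDr; near: x; by apply: nbhs_ninfty_le; rewrite num_real.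
Unshelve. all: end_near. Qed.

Lemma is_derive_cos_affine (m k x : R) :
  is_derive x (1 : R) (fun y => cos (m * y + k)) (- (m * sin (m * x + k))).
Proof.
have h : is_derive x (1 : R) (fun y => m * y + k) m.
  by apply: is_derive_eq; rewrite /GRing.scale/= ; ring.
apply: is_derive_eq (is_derive1_comp (is_derive_cos _) h) _ => /=; ring.
Qed.

Lemma is_derive_sin_affine (m k x : R) :
  is_derive x (1 : R) (fun y => sin (m * y + k)) (m * cos (m * x + k)).
Proof.
have h : is_derive x (1 : R) (fun y => m * y + k) m.
  by apply: is_derive_eq; rewrite /GRing.scale/= ; ring.
apply: is_derive_eq (is_derive1_comp (is_derive_sin _) h) _ => /=; ring.
Qed.

End gauss1.

(** * The Fourier transform of the one-dimensional Gaussian *)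

Section fourier1.
Set Implicit Arguments.
Unset Strict Implicit.
Variable R : realType.
Local Notation mu := (@lebesgue_measure R).

Lemma cos_gauss1_integrable (c b m k : R) : 0 < c ->
  mu.-integrable setT (fun x => (cos (m * (x - b) + k) * gauss1 c b x)%:E).
Proof.
move=> c0; have [ig _] := gauss1_integral b c0.
apply: le_integrable ig => //.
  apply/measurable_EFinP; apply: measurable_funM; last exact: measurable_gauss1.
  apply: measurableT_comp; first exact: continuous_measurable_fun (@continuous_cos R).
  apply: measurable_funD => //; apply: measurable_funM => //.
  exact: measurable_funB.
move=> x _ /=; rewrite lee_fin normrM (ger0_norm (gauss1_ge0 _ _ _)) ?gauss1_ge0//.
by rewrite ler_piMl ?gauss1_ge0 ?cos_max.
Qed.

(* The integral satisfies the ODE F' = - (m / 2c) F, by differentiating under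
   the integral sign and integrating by parts. *)
Lemma is_derive_cos_gauss1 (c b k a : R) : 0 < c ->
  let F m := \int[mu]_x (cos (m * (x - b) + k) * gauss1 c b x) in
  is_derive a (1 : R) F (- (a / (2 * c)) * F a).
Proof.
move=> c0 F.
pose f m x := cos (m * (x - b) + k) * gauss1 c b x.
have Df m x : is_derive m (1 : R) (f ^~ x) (- ((x - b) * sin (m * (x - b) + k)) * gauss1 c b x).
  rewrite /f; under eq_fun do rewrite mulrC (mulrC _ (x - b)).
  have h := is_derive_cos_affine (x - b) k m.
  by apply: is_derive_eq; rewrite /GRing.scale/= (mulrC m); ring.
have d1E m x : partial1of2 f m x = - ((x - b) * sin (m * (x - b) + k)) * gauss1 c b x.
  by rewrite partial1of2E; have [_ ->] := Df m x.
have Ia : `]a - 1, a + 1[%classic a.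
  by rewrite /= in_itv/= ltrBlDr ltrDl ltr01.
have intf x : `]a - 1, a + 1[%classic x -> mu.-integrable setT (EFin \o f x).
  by move=> _; exact: cos_gauss1_integrable.
have der x y : `]a - 1, a + 1[%classic x -> setT y -> derivable (f ^~ y) x 1.
  by move=> _ _; have [] := Df x y.
have G0 y : 0 <= `|y - b| * gauss1 c b y by rewrite mulr_ge0// expR_ge0.
have intG := gauss1_moment_integrable b c0.
have Gub x y : `]a - 1, a + 1[%classic x -> setT y ->
    `|partial1of2 f x y| <= `|y - b| * gauss1 c b y.
  move=> _ _; rewrite d1E normrM normrN normrM [X in _ * X <= _](ger0_norm (gauss1_ge0 _ _ _)) ?gauss1_ge0//.
  by rewrite ler_wpM2r ?expR_ge0// ler_piMr// sin_max.
have dF := @derivable_under_integral R _ _ mu f setT measurableT a _ _ Ia intf der _ G0 intG Gub.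
have FE := @differentiation_under_integral R _ _ mu f setT measurableT a _ _ Ia intf der _ G0 intG Gub.
apply: DeriveDef; first exact: dF.
rewrite -derive1E FE.
(* The derivative [d] of [D] is [a] times the integrand of [F a] plus 2c times the integrand of its
   derivative, so the vanishing of the integral of [d] is the differential equation. *)
pose D x := sin (a * x + (k - a * b)) * gauss1 c b x.
pose d x := a * (cos (a * (x - b) + k) * gauss1 c b x) +
            2 * c * (- ((x - b) * sin (a * (x - b) + k)) * gauss1 c b x).
have aff x : a * (x - b) + k = a * x + (k - a * b) by ring.
have Dd x : is_derive x (1 : R) D (d x).
  have h1 := is_derive_sin_affine a (k - a * b) x.
  have h2 := is_derive_gauss1 c b x.
  apply: is_derive_eq; rewrite /GRing.scale/= /d aff; ring.
have mpart : measurable_fun setT (fun x : R => - ((x - b) * sin (a * (x - b) + k)) * gauss1 c b x).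
  apply: measurable_funM; last exact: measurable_gauss1.
  apply: measurableT_comp => //; apply: measurable_funM; first exact: measurable_funB.
  apply: measurableT_comp; first exact: continuous_measurable_fun (@continuous_sin R).
  apply: measurable_funD => //; apply: measurable_funM => //.
  exact: measurable_funB.
have i2 : mu.-integrable setT (fun x => (- ((x - b) * sin (a * (x - b) + k)) * gauss1 c b x)%:E).
  apply: le_integrable intG => //; first exact/measurable_EFinP.
  move=> x _; rewrite lee_fin -d1E (ger0_norm (G0 x)).
  exact: Gub.
have i1 := cos_gauss1_integrable b a k c0.
have id : mu.-integrable setT (EFin \o d).
  rewrite (_ : EFin \o d = fun x => (a%:E * (cos (a * (x - b) + k) * gauss1 c b x)%:E
    + (2 * c)%:E * (- ((x - b) * sin (a * (x - b) + k)) * gauss1 c b x)%:E)%E)//.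
  by apply: integrableD => //; exact: integrableZl.
have cd : continuous d.
  pose d' x := - a * (a * sin (a * x + (k - a * b))) * gauss1 c b x +
    a * cos (a * x + (k - a * b)) * (- (2 * c * (x - b)) * gauss1 c b x) +
    (- 2 * c) * ((sin (a * x + (k - a * b)) + (x - b) * (a * cos (a * x + (k - a * b)))) * gauss1 c b x +
    (x - b) * sin (a * x + (k - a * b)) * (- (2 * c * (x - b)) * gauss1 c b x)).
  apply: (@is_derive1_continuous _ _ d') => x.
  rewrite /d; under eq_fun do rewrite aff.
  have h1 := is_derive_sin_affine a (k - a * b) x.
  have h2 := is_derive_gauss1 c b x.
  have h3 := is_derive_cos_affine a (k - a * b) x.
  apply: is_derive_eq; rewrite /GRing.scale/= /d'; ring.
have [Dy Dny] := @gauss1_cvg0 R c b (fun x => sin (a * x + (k - a * b))) c0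
  (fun x => sin_max _).
have := integral_derivative0 Dd cd id Dy Dny.
rewrite RintegralD//; [|exact: RintegrableZ|exact: RintegrableZ].
rewrite RintegralZl// RintegralZl// => E.
have -> : \int[mu]_x partial1of2 f a x =
    \int[mu]_x (- ((x - b) * sin (a * (x - b) + k)) * gauss1 c b x).
  by apply: eq_Rintegral => x _; rewrite d1E.
set J := \int[mu]_x (- _ * _) in E *.
have : 2 * c * J = - (a * F a) by apply/eqP; rewrite -addr_eq0 addrC; apply/eqP.
move=> /(congr1 (fun z => z / (2 * c))); rewrite mulrAC divff ?mul1r; last by rewrite mulf_neq0// gt_eqF.
by move=> ->; field; rewrite gt_eqF.
Qed.

(** exp (m^2 / 4c) is an integrating factor, so [H] is constant and is evaluated at m = 0. A free
    phase [k] makes one formula serve for the cosine and, shifted by pi/2, for the sine. *)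
Lemma cos_gauss1_integral (c b m k : R) : 0 < c ->
  \int[mu]_x (cos (m * (x - b) + k) * gauss1 c b x) =
  cos k * expR (- (m ^+ 2 / (4 * c))) * Num.sqrt (pi / c).
Proof.
move=> c0.
pose F m := \int[mu]_x (cos (m * (x - b) + k) * gauss1 c b x).
pose H m := expR (m ^+ 2 / (4 * c)) * F m.
have HE : H m = H 0.
  apply: is_derive_0_is_cst => x.
  have h1 : is_derive x (1 : R) F (- (x / (2 * c)) * F x) := is_derive_cos_gauss1 b k x c0.
  have h2 : is_derive x (1 : R) (fun y => expR (y ^+ 2 / (4 * c))) (x / (2 * c) * expR (x ^+ 2 / (4 * c))).
    have h : is_derive x (1 : R) (fun y => y ^+ 2 / (4 * c)) (x / (2 * c)).
      by apply: is_derive_eq; rewrite /GRing.scale/=; field; rewrite gt_eqF.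
    by apply: is_derive_eq (is_derive1_comp (is_derive_expR _) h) _; rewrite mulrC.
  apply: is_derive_eq; rewrite /GRing.scale/=; ring.
have F0 : F 0 = cos k * Num.sqrt (pi / c).
  have [ig gE] := gauss1_integral b c0.
  rewrite -gE /F -RintegralZl//; apply: eq_Rintegral => x _.
  by rewrite mul0r add0r.
rewrite -/(F m) expRN mulrAC -F0.
apply: (mulfI (lt0r_neq0 (expR_gt0 (m ^+ 2 / (4 * c))))).
rewrite -/(H m) HE /H expr0n/= mul0r expR0 mul1r.
by rewrite mulrCA mulfV ?mulr1// lt0r_neq0// expR_gt0.
Qed.

End fourier1.

(** * Gaussians on R^n and their Fourier transforms *)

Section gaussn.
Set Implicit Arguments.
Unset Strict Implicit.
Variable R : realType.
Local Notation mu := (@lebesgue_measure R).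
Local Notation V n := ('rV[R]_n).
Local Notation leb n := (@lebesgue_rV R n).

Lemma dotDl n (x y z : V n) : dot (x + y) z = dot x z + dot y z.
Proof. by rewrite /dot -big_split; apply: eq_bigr => i _; rewrite mxE mulrDl. Qed.

Lemma dotC n (x y : V n) : dot x y = dot y x.
Proof. by apply: eq_bigr => i _; rewrite mulrC. Qed.

Lemma dotDr n (x y z : V n) : dot z (x + y) = dot z x + dot z y.
Proof. by rewrite dotC dotDl !(dotC z). Qed.

Lemma dotZl n a (x y : V n) : dot (a *: x) y = a * dot x y.
Proof. by rewrite /dot mulr_sumr; apply: eq_bigr => i _; rewrite mxE mulrA. Qed.

Lemma dotZr n a (x y : V n) : dot x (a *: y) = a * dot x y.
Proof. by rewrite dotC dotZl dotC. Qed.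

Lemma dotNl n (x y : V n) : dot (- x) y = - dot x y.
Proof. by rewrite -scaleN1r dotZl mulN1r. Qed.

Lemma dotNr n (x y : V n) : dot x (- y) = - dot x y.
Proof. by rewrite dotC dotNl dotC. Qed.

Lemma dot0l n (x : V n) : dot 0 x = 0.
Proof. by rewrite -(scale0r (0 : V n)) dotZl mul0r. Qed.

Lemma dotxx_ge0 n (x : V n) : 0 <= dot x x.
Proof. by apply: sumr_ge0 => i _; exact: sqr_ge0. Qed.

Definition gaussn n (c : R) (b x : V n) : R := expR (- (c * dot (x - b) (x - b))).

Lemma gaussn_ge0 n c (b x : V n) : 0 <= gaussn c b x.
Proof. exact: expR_ge0. Qed.

Lemma measurable_dot n (m : V n) : measurable_fun setT (dot m).
Proof.
apply: measurable_sum => i; apply: measurable_funM => //.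
exact: measurable_coord.
Qed.

Lemma measurable_gaussn n c (b : V n) : measurable_fun setT (gaussn c b).
Proof.
apply: measurableT_comp => //; apply: measurableT_comp => //.
apply: measurable_funM => //; apply: measurable_sum => i.
have mc : measurable_fun setT (fun x : V n => (x - b) 0 i).
  under eq_fun do rewrite !mxE.
  by apply: measurable_funB => //; exact: measurable_coord.
exact: measurable_funM.
Qed.

Lemma measurable_cosR : measurable_fun setT (@cos R).
Proof. exact: continuous_measurable_fun (@continuous_cos R). Qed.

Lemma measurable_sinR : measurable_fun setT (@sin R).
Proof. exact: continuous_measurable_fun (@continuous_sin R). Qed.

Definition hdrV n (x : V n.+1) : R := x 0 ord0.
Definition tlrV n (x : V n.+1) : V n := \row_j x 0 (lift ord0 j).

Lemma hdrV_cons n (p : R * V n) : hdrV (consrV p) = p.1.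
Proof.
rewrite /hdrV /consrV (_ : ord0 = lshift n (ord0 : 'I_1)); last exact/val_inj.
by rewrite [LHS]row_mxEl mxE.
Qed.

Lemma tlrV_cons n (p : R * V n) : tlrV (consrV p) = p.2.
Proof.
apply/rowP => j; rewrite mxE /consrV.
rewrite (_ : lift ord0 j = rshift 1 j); last exact/val_inj.
exact: row_mxEr.
Qed.

Lemma dot_hdtl n (x y : V n.+1) : dot x y = hdrV x * hdrV y + dot (tlrV x) (tlrV y).
Proof.
by rewrite /dot big_ord_recl; congr (_ + _); apply: eq_bigr => i _; rewrite !mxE.
Qed.

Lemma hdrVB n (x y : V n.+1) : hdrV (x - y) = hdrV x - hdrV y.
Proof. by rewrite /hdrV !mxE. Qed.

Lemma tlrVB n (x y : V n.+1) : tlrV (x - y) = tlrV x - tlrV y.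
Proof. by apply/rowP => j; rewrite !mxE. Qed.

Lemma gaussn_cons n c (b : V n.+1) p :
  gaussn c b (consrV p) = gauss1 c (hdrV b) p.1 * gaussn c (tlrV b) p.2.
Proof.
rewrite /gaussn /gauss1 -expRD dot_hdtl hdrVB tlrVB hdrV_cons tlrV_cons.
by congr expR; ring.
Qed.

Lemma prod_integrable n (f : R -> R) (g : V n -> R) :
  mu.-integrable setT (EFin \o f) -> (leb n).-integrable setT (EFin \o g) ->
  (mu \x leb n)%E.-integrable setT (fun p => (f p.1 * g p.2)%:E).
Proof.
move=> fi gi.
have mf := Rintegrable_measurable fi.
have mg := Rintegrable_measurable gi.
apply/integrable12ltyP.
  apply/measurable_EFinP; apply: measurable_funM.
    exact: (measurableT_comp mf measurable_fst).
  exact: (measurableT_comp mg measurable_snd).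
pose G := (\int[leb n]_y `|(g y)%:E|)%E.
have gfin : G \is a fin_num.
  rewrite ge0_fin_numE; last exact: integral_ge0.
  by move/integrableP : gi => [].
have E x : (\int[leb n]_y `|(f x * g y)%:E| = `|(f x)%:E| * G)%E.
  under eq_integral do rewrite EFinM abseM.
  rewrite ge0_integralZl//; apply: measurableT_comp => //; exact/measurable_EFinP.
under eq_integral do rewrite /= E.
rewrite -(fineK gfin) ge0_integralZr//=; last 2 first.
  by apply/measurable_EFinP; apply: measurableT_comp.
  by rewrite lee_fin fine_ge0// integral_ge0.
rewrite lte_mul_pinfty//; [exact: integral_ge0| |exact: ltry].
rewrite ge0_fin_numE; last exact: integral_ge0.
by move/integrableP : fi => [].
Qed.

(** The induction step on the dimension: [lebesgue_rV] is a pushforward along [consrV], so the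
    integral moves to the product, where Fubini applies. [h] is the inner integral, supplied in
    closed form by the caller. *)
Lemma Rintegral_rV_S n (f : V n.+1 -> R) (h : R -> R) : measurable_fun setT f ->
  (mu \x leb n)%E.-integrable setT (fun p => (f (consrV p))%:E) ->
  (forall a, \int[leb n]_y (f (consrV (a, y)))%:E = (h a)%:E)%E ->
  (leb n.+1).-integrable setT (EFin \o f) /\
  \int[leb n.+1]_x f x = \int[mu]_a h a.
Proof.
move=> mf fi hE.
have mf' : measurable_fun setT (EFin \o f) by exact/measurable_EFinP.
pose X : measurableType _ :=
  ((g_sigma_algebraType (R.-ocitv.-measurable) * 'rV[R]_n)%type : measurableType _).
pose pr : {measure set X -> \bar R} := (mu \x leb n)%E.
have mc : measurable_fun [set: X] (@consrV R n) := @measurable_consrV R n.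
split.
  exact: (@integrable_pushforward _ _ X _ R (@consrV R n) mc pr setT _ mf' fi measurableT).
rewrite /Rintegral; congr fine.
have -> : (\int[leb n.+1]_x (f x)%:E = \int[pr]_p (f (consrV p))%:E)%E.
  exact: (@integral_pushforward _ _ X _ R (@consrV R n) mc pr setT _ mf' fi measurableT).
have <- := @integral12_prod_meas1 _ _ _ _ R mu (leb n) _ fi.
by apply: eq_integral => a _; rewrite /fubini_F/=.
Qed.

Lemma measurable_cos_gaussn n c (b m : V n) k :
  measurable_fun setT (fun x => cos (dot m x + k) * gaussn c b x).
Proof.
apply: measurable_funM; last exact: measurable_gaussn.
apply: measurableT_comp; first exact: measurable_cosR.
by apply: measurable_funD => //; exact: measurable_dot.
Qed.

Lemma gaussn_integrable n c (b : V n) : 0 < c ->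
  (leb n).-integrable setT (EFin \o gaussn c b).
Proof.
move=> c0; elim: n b => [|p IH] b'.
  apply/integrableP; split; first by apply/measurable_EFinP; exact: measurable_gaussn.
  rewrite integral_dirac//; last first.
    apply: measurableT_comp => //; apply/measurable_EFinP; exact: measurable_gaussn.
  by rewrite diracE mem_set// mul1e /= ltry.
have [] // := @Rintegral_rV_S p (gaussn c b')
    (fun a => gauss1 c (hdrV b') a * \int[leb p]_y gaussn c (tlrV b') y).
- exact: measurable_gaussn.
- under eq_fun do rewrite gaussn_cons.
  apply: prod_integrable (IH _).
  by have [] := gauss1_integral (hdrV b') c0.
- move=> a; under eq_integral do rewrite gaussn_cons EFinM /=.
  rewrite integralZl//; last exact: IH.
  rewrite EFinM /Rintegral fineK//; apply: integrable_fin_num => //; exact: IH.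
Qed.

Lemma cos_gaussn_integrable n (c : R) (b m : V n) (k : R) : 0 < c ->
  (leb n).-integrable setT (fun x => (cos (dot m x + k) * gaussn c b x)%:E).
Proof.
move=> c0; apply: Rintegrable_le (gaussn_integrable b c0) => [|x].
  exact: measurable_cos_gaussn.
by rewrite normrM (ger0_norm (gaussn_ge0 _ _ _)) ler_piMl ?gaussn_ge0 ?cos_max.
Qed.

Theorem cos_gaussn_integral n (c : R) (b m : V n) (k : R) : 0 < c ->
  \int[leb n]_x (cos (dot m x + k) * gaussn c b x) =
  cos (dot m b + k) * expR (- (dot m m / (4 * c))) * Num.sqrt (pi / c) ^+ n.
Proof.
move=> c0.
elim: n b m k => [|n IH] b m k.
  rewrite /Rintegral integral_dirac//; last first.
    by apply/measurable_EFinP; exact: measurable_cos_gaussn.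
  rewrite diracE mem_set// mul1e /= /gaussn /dot !big_ord0.
  by rewrite mul0r mulr0 expr0 mulr1.
(* The part of the inner integral independent of the first coordinate [a]. The remaining cosine
   carries [a] in its phase, which is why the induction is over all phases and why the outer
   integral is again of the one-dimensional form. *)
pose C := expR (- (dot (tlrV m) (tlrV m) / (4 * c))) * Num.sqrt (pi / c) ^+ n.
have [] // := @Rintegral_rV_S n (fun x => cos (dot m x + k) * gaussn c b x)
  (fun a => C * (cos (hdrV m * (a - hdrV b) + (dot m b + k)) * gauss1 c (hdrV b) a)).
- exact: measurable_cos_gaussn.
- have := prod_integrable (gauss1_integral (hdrV b) c0).1 (gaussn_integrable (tlrV b) c0).
  apply: Rintegrable_le.
    exact: (measurableT_comp (measurable_cos_gaussn c b m k) (@measurable_consrV R n)).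
  have g0 p : 0 <= gauss1 c (hdrV b) p.1 * gaussn c (tlrV b) p.2.
    by apply: mulr_ge0; [exact: gauss1_ge0|exact: gaussn_ge0].
  move=> p; rewrite gaussn_cons normrM (ger0_norm (g0 p)).
  by apply: ler_piMl; [exact: g0|exact: cos_max].
- move=> a.
  have E y : cos (dot m (consrV (a, y)) + k) * gaussn c b (consrV (a, y)) =
      gauss1 c (hdrV b) a *
      (cos (dot (tlrV m) y + (hdrV m * a + k)) * gaussn c (tlrV b) y).
    rewrite gaussn_cons dot_hdtl hdrV_cons tlrV_cons/=.
    by rewrite mulrCA (_ : _ * _ + _ + k = dot (tlrV m) y + (hdrV m * a + k))//; ring.
  under eq_integral do rewrite E EFinM.
  rewrite integralZl//; last exact: cos_gaussn_integrable.
  rewrite -[X in (_ * X)%E]fineK; last by apply: integrable_fin_num => //; exact: cos_gaussn_integrable.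
  rewrite -EFinM; congr EFin; rewrite [X in _ * X]IH dot_hdtl /C.
  rewrite (_ : hdrV m * (a - hdrV b) + _ = dot (tlrV m) (tlrV b) + (hdrV m * a + k)); ring.
move=> _ ->.
rewrite RintegralZl//; last exact: cos_gauss1_integrable.
rewrite cos_gauss1_integral// /C (exprS _ n).
have -> : - (dot m m / (4 * c)) =
    - (hdrV m ^+ 2 / (4 * c)) + - (dot (tlrV m) (tlrV m) / (4 * c)).
  by rewrite [dot m m]dot_hdtl; field; rewrite gt_eqF.
by rewrite expRD; ring.
Qed.

End gaussn.

(** * Bounded pointwise limits of trigonometric polynomials *)

Section bounded_pointwise_closure.
Set Implicit Arguments.
Unset Strict Implicit.
Variables (R : realType) (T : Type) (A : (T -> R) -> Prop).

(** An inductive closure, because one passage to the limit does not reach all measurable functions: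
    limits are iterated. Each sequence has its own uniform bound [M], as dominated convergence will
    require. *)
Inductive bpc : (T -> R) -> Prop :=
| bpc_base p : A p -> bpc p
| bpc_lim (g : nat -> T -> R) (h : T -> R) (M : R) : (forall j, bpc (g j)) ->
    (forall j x, `|g j x| <= M) -> (forall x, g j x @[j --> \oo] --> h x) -> bpc h.

Hypothesis A_bounded : forall p, A p -> exists M, forall x, `|p x| <= M.
Hypothesis A_cst : forall c, A (fun=> c).
Hypothesis AD : forall p q, A p -> A q -> A (fun x => p x + q x).
Hypothesis AM : forall p q, A p -> A q -> A (fun x => p x * q x).

Lemma limit_le_bound (g : nat -> R) (l M : R) :
  (forall j, `|g j| <= M) -> g j @[j --> \oo] --> l -> `|l| <= M.
Proof.
move=> gM gl; have cl : `|g j| @[j --> \oo] --> `|l| by exact: cvg_norm.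
rewrite -(cvg_lim _ cl)//; apply: limr_le; first by apply/cvg_ex; exists `|l|.
by apply: nearW => j; exact: gM.
Qed.

Lemma bpc_bounded h : bpc h -> exists M, forall x, `|h x| <= M.
Proof.
elim=> [p /A_bounded//|g {}h M _ _ gM gh]; exists M => x.
by apply: limit_le_bound (gh x) => j; exact: gM.
Qed.

(** Induction on one argument at a time: while one runs through a sequence the other stays fixed,
    and its boundedness keeps the new sequence uniformly bounded. *)
Lemma bpcD f g : bpc f -> bpc g -> bpc (fun x => f x + g x).
Proof.
move=> bf bg; elim: bf => [p Ap|k h M _ IH kM kh].
  elim: bg => [q Aq|k h M _ IH kM kh]; first exact/bpc_base/AD.
  have [N pN] := A_bounded Ap.
  apply: (@bpc_lim (fun j x => p x + k j x) _ (N + M)) => //.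
    by move=> j x; apply: le_trans (ler_normD _ _) _; rewrite lerD.
  by move=> x; apply: cvgD => //; exact: cvg_cst.
have [N gN] := bpc_bounded bg.
apply: (@bpc_lim (fun j x => k j x + g x) _ (M + N)) => //.
  by move=> j x; apply: le_trans (ler_normD _ _) _; rewrite lerD.
by move=> x; apply: cvgD => //; exact: cvg_cst.
Qed.

Lemma bpcM f g : bpc f -> bpc g -> bpc (fun x => f x * g x).
Proof.
move=> bf bg; elim: bf => [p Ap|k h M _ IH kM kh].
  elim: bg => [q Aq|k h M _ IH kM kh]; first exact/bpc_base/AM.
  have [N pN] := A_bounded Ap.
  apply: (@bpc_lim (fun j x => p x * k j x) _ (N * M)) => //.
    by move=> j x; rewrite normrM ler_pM.
  by move=> x; apply: cvgM => //; exact: cvg_cst.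
have [N gN] := bpc_bounded bg.
apply: (@bpc_lim (fun j x => k j x * g x) _ (M * N)) => //.
  by move=> j x; rewrite normrM ler_pM.
by move=> x; apply: cvgM => //; exact: cvg_cst.
Qed.

Lemma bpc_cst c : bpc (fun=> c).
Proof. exact/bpc_base/A_cst. Qed.

Lemma bpcZ c f : bpc f -> bpc (fun x => c * f x).
Proof. exact/bpcM/bpc_cst. Qed.

Lemma bpc_sum (I : Type) (s : seq I) (F : I -> T -> R) :
  (forall i, bpc (F i)) -> bpc (fun x => \sum_(i <- s) F i x).
Proof.
move=> bF; elim: s => [|i s IH].
  by under eq_fun do rewrite big_nil; exact: bpc_cst.
by under eq_fun do rewrite big_cons; exact: bpcD.
Qed.

Lemma bpc_prod (I : Type) (s : seq I) (F : I -> T -> R) :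
  (forall i, bpc (F i)) -> bpc (fun x => \prod_(i <- s) F i x).
Proof.
move=> bF; elim: s => [|i s IH].
  by under eq_fun do rewrite big_nil; exact: bpc_cst.
by under eq_fun do rewrite big_cons; exact: bpcM.
Qed.

Lemma bpcX n f : bpc f -> bpc (fun x => f x ^+ n).
Proof.
move=> bf; elim: n => [|n IH]; first exact: bpc_cst.
by under eq_fun do rewrite exprS; exact: bpcM.
Qed.

(** The partial sums of the exponential series are polynomials in [f], bounded by [expR M] uniformly
    in their length. Exponentials are the means of manufacturing indicators. *)
Lemma bpc_expR f : bpc f -> bpc (fun x => expR (f x)).
Proof.
move=> bf; have [M fM] := bpc_bounded bf.
apply: (@bpc_lim (fun j x => series (exp_coeff (f x)) j) _ (expR M)).
- move=> j; rewrite /series/=; apply: bpc_sum => i.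
  rewrite /exp_coeff/=; under eq_fun do rewrite mulrC.
  exact/bpcZ/bpcX.
- move=> j x; apply: le_trans (ler_norm_sum _ _ _) _.
  apply: (@le_trans _ _ (series (exp_coeff M) j)).
    apply: ler_sum => i _; rewrite /exp_coeff/= normrM ler_pM//.
      by rewrite normrX lerXn2r// ?nnegrE//; apply: le_trans (fM x).
    by rewrite ger0_norm// invr_ge0.
  rewrite /expR; apply: nondecreasing_cvgn_le; last exact: is_cvg_series_exp_coeff.
  apply: nondecreasing_series => i _ _; apply: exp_coeff_ge0.
  exact: le_trans (fM x).
- by move=> x; exact: is_cvg_series_exp_coeff.
Qed.

Lemma cvg_expRN_mul (a : R) : 0 < a -> expR (- (j%:R * a)) @[j --> \oo] --> (0 : R).
Proof.
move=> a0; apply/cvgr0Pnorm_le => e e0; near=> j.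
rewrite ger0_norm ?expR_ge0// expRN -[leRHS]invrK.
rewrite lef_pV2 ?posrE ?invr_gt0 ?expR_gt0//.
apply: le_trans (expR_ge1Dx _).
have : e^-1 / a <= j%:R by near: j; exact: nbhs_infty_ger.
by rewrite ler_pdivrMr//; lra.
Unshelve. all: end_near. Qed.

(* [expR (- expR (- j h))] tends to the indicator of [0 < h] off the zeros
   of [h], which are detected by [expR (- j h ^+ 2)]. *)
Lemma bpc_gt0 (f : T -> R) : bpc f -> bpc (fun x : T => ((0 < f x)%R)%:R).
Proof.
move=> bf.
pose a x : R := if 0 < f x then 1 else if f x == 0 then expR (-1) else 0.
have ba : bpc a.
  apply: (@bpc_lim (fun j x => expR (- 1 * expR (- j%:R * f x))) _ 1).
  - by move=> j; apply/bpc_expR/bpcZ/bpc_expR/bpcZ.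
  - move=> j x; rewrite ger0_norm ?expR_ge0// -[leRHS]expR0 ler_expR mulN1r.
  - move=> x; rewrite /a; case: ltgtP => [fx|fx|<-].
    + rewrite -[X in _ --> X]expR0; apply: continuous_cvg; first exact: continuous_expR.
      rewrite -[X in _ --> X](mulr0 (-1)); apply: cvgM; first exact: cvg_cst.
      under eq_fun do rewrite mulNr; exact: cvg_expRN_mul.
    + have fx' : 0 < - f x by rewrite oppr_gt0.
      apply: (squeeze_cvgr _ (cvg_cst 0) (cvg_expRN_mul fx')).
      apply: nearW => j; rewrite expR_ge0/= ler_expR mulN1r lerN2 mulrN -mulNr.
      by apply: le_trans (expR_ge1Dx _); rewrite lerDr.
    + by under eq_fun do rewrite mulr0 expR0 mulr1; exact: cvg_cst.
pose b x : R := ((f x == 0)%R)%:R.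
have bb : bpc b.
  apply: (@bpc_lim (fun j x => expR (- j%:R * f x ^+ 2)) _ 1).
  - by move=> j; apply/bpc_expR/bpcZ/bpcX.
  - move=> j x; rewrite ger0_norm ?expR_ge0// -[leRHS]expR0 ler_expR mulNr.
    by rewrite oppr_le0 mulr_ge0// sqr_ge0.
  - move=> x; rewrite /b; case: eqVneq => [->|fx].
      by under eq_fun do rewrite expr0n/= mulr0 expR0; exact: cvg_cst.
    under eq_fun do rewrite mulNr; apply: cvg_expRN_mul.
    by rewrite exprn_even_gt0.
(* The limit [a] differs from the wanted indicator only on the zero set of [f], by [expR (-1)]. *)
rewrite (_ : (fun x => _) = fun x => a x + (- expR (-1)) * b x).
  exact: bpcD ba (bpcZ _ bb).
apply/funext => x; rewrite /a /b; case: ltgtP => [fx|fx|fx];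
  by rewrite ?mulr0 ?addr0 ?mulr1 ?subrr.
Qed.

(** Complements are affine in the indicator. A finite union has indicator 1 - prod (1 - 1_F), and at
    each point these stabilise to the indicator of the countable union. *)
Lemma bpc_sigma_algebra : sigma_algebra setT [set B | bpc \1_B].
Proof.
split => /=.
- by rewrite indic0; exact: bpc_cst.
- move=> B bB; rewrite setTD (_ : \1_(~` B) = fun x => 1 + (- 1) * \1_B x).
    exact: bpcD (bpc_cst 1) (bpcZ _ bB).
  by apply/funext => x; rewrite !indicE in_setC; case: (_ \in _); rewrite ?mulr1 ?mulr0 ?addr0 ?subrr.
- move=> F bF.
  have bF' i : bpc (fun x => 1 + (- 1) * \1_(F i) x) by exact: bpcD (bpc_cst 1) (bpcZ _ (bF i)).
  have ind01 (B : set T) (x : T) : 0 <= 1 + (-1) * (\1_B x : R) <= 1.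
    by rewrite indicE; case: (_ \in _) => /=; rewrite ?mulr1 ?mulr0 ?subrr ?addr0 ?lexx ?ler01.
  apply: (@bpc_lim (fun j x => 1 + (- 1) * \prod_(i < j) (1 + (- 1) * \1_(F i) x)) _ 1).
  + by move=> j; apply: bpcD (bpc_cst 1) (bpcZ _ (bpc_prod _ (fun i : 'I_j => bF' i))).
  + move=> j x; have : 0 <= \prod_(i < j) (1 + (- 1) * \1_(F i) x : R) <= 1.
      apply/andP; split; first by apply: prodr_ge0 => i _; case/andP: (ind01 (F i) x).
      by apply: prodr_ile1 => i _; exact: ind01.
    by move=> /andP[h0 h1]; rewrite mulN1r ger0_norm; lra.
  + move=> x; rewrite indicE; case: (boolP (x \in _)) => [/[!inE] -[i _ Fix]|xF].
      apply: cvg_near_cst; near=> j.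
      have ij : (i < j)%N by near: j; exact: nbhs_infty_gt.
      rewrite (bigD1 (Ordinal ij))//= indicE mem_set//.
      by rewrite mulr1 subrr mul0r mulr0 addr0.
    rewrite [X in X @ _ --> _](_ : _ = cst 0); first exact: cvg_cst.
    apply/funext => j; rewrite big1 ?mulr1 ?subrr// => i _.
    rewrite indicE memNset ?mulr0 ?addr0// => Fix.
    by move/negP : xF; apply; rewrite inE; exists i.
Unshelve. all: end_near. Qed.

End bounded_pointwise_closure.

(** * An L^2 bound from a quadratic form tested on a dense class *)

Section l2_duality.
Import HBNNSimple.
Set Implicit Arguments.
Unset Strict Implicit.
Context d (T : measurableType d) (R : realType) (mu : {measure set T -> \bar R}).
Variable A : (T -> R) -> Prop.
Hypothesis A_bounded : forall p, A p -> exists M, forall x, `|p x| <= M.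
Hypothesis A_cst : forall c, A (fun=> c).
Hypothesis AD : forall p q, A p -> A q -> A (fun x => p x + q x).
Hypothesis AM : forall p q, A p -> A q -> A (fun x => p x * q x).
Hypothesis A_measurable : forall p, A p -> measurable_fun setT p.
Hypothesis A_indic : forall B : set T, measurable B -> bpc A (\1_B).

(** After adding [M] the function is nonnegative, hence an increasing limit of simple functions,
    which are finite combinations of indicators and bounded by 2M. *)
Lemma bpc_bounded_measurable (h : T -> R) M : measurable_fun setT h ->
  (forall x, `|h x| <= M) -> bpc A h.
Proof.
move=> mh hM.
have hM0 x : 0 <= h x + M <= M + M.
  by have := hM x; rewrite ler_norml => /andP[h1 h2]; apply/andP; split; lra.
have mf : measurable_fun setT (fun x => (h x + M)%:E).
  by apply/measurable_EFinP; exact: measurable_funD.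
have f0 x : setT x -> (0 <= (h x + M)%:E)%E by rewrite lee_fin; case/andP: (hM0 x).
pose g (j : nat) : T -> R := nnsfun_approx measurableT mf j.
have gl x : g j x @[j --> \oo] --> h x + M.
  exact: (fine_cvg (@cvg_nnsfun_approx _ T R setT measurableT _ mf f0 x I)).
have -> : h = fun x => (h x + M) + (- M) by apply/funext => x; rewrite addrK.
apply: bpcD => //; last exact: bpc_cst.
apply: (@bpc_lim _ _ _ (fun j x => g j x) _ (M + M)) => //.
  move=> j; rewrite /g; under eq_fun do rewrite fimfunEord.
  by apply: bpc_sum => // y; apply: bpcZ => //; exact: A_indic.
move=> j x; rewrite ger0_norm//.
apply: le_trans (_ : h x + M <= _); last by case/andP: (hM0 x).
rewrite -(cvg_lim _ (gl x))//.
apply: (@nondecreasing_cvgn_le _ (g ^~ x)).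
  by move=> a b ab; have /lefP := nd_nnsfun_approx measurableT mf ab; exact.
by apply/cvg_ex; exists (h x + M); exact: gl.
Qed.

Variables (u w : T -> R) (K : R).
Hypothesis mu_ : measurable_fun setT u.
Hypothesis mw : measurable_fun setT w.
Hypothesis w0 : forall x, 0 < w x <= 1.
Hypothesis wi : mu.-integrable setT (EFin \o w).
Hypothesis uwi : mu.-integrable setT (fun x => (u x * w x)%:E).
Hypothesis uK : forall p, A p ->
  \int[mu]_x (2 * u x * p x * w x - p x ^+ 2 * w x ^+ 2) <= K.

Let w_gt0 x : 0 < w x. Proof. by case/andP: (w0 x). Qed.

Let Q (h : T -> R) x := 2 * u x * h x * w x - h x ^+ 2 * w x ^+ 2.

Let measurable_Q (h : T -> R) : measurable_fun setT h -> measurable_fun setT (Q h).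
Proof.
move=> mh; apply: measurable_funB; apply: measurable_funM => //.
- by apply: measurable_funM => //; exact: measurable_funM.
- exact: measurable_funX.
- exact: measurable_funX.
Qed.

Let Q_bound (h : T -> R) (M : R) x : `|h x| <= M -> `|Q h x| <= 2 * M * `|u x * w x| + M ^+ 2 * w x.
Proof.
move=> hM; have M0 : 0 <= M by exact: le_trans hM.
apply: le_trans (ler_normB _ _) _; apply: lerD.
  rewrite (_ : 2 * u x * h x * w x = 2 * (h x * (u x * w x))); last by ring.
  by rewrite normrM normrM ger0_norm// -!mulrA ler_pM2l// ler_wpM2r.
rewrite normrM normrX [X in _ * X]ger0_norm ?sqr_ge0//.
apply: ler_pM; rewrite ?sqr_ge0//; first by rewrite lerXn2r// nnegrE.
(* The bound w <= 1 replaces w^2 by the integrable w. *)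
by rewrite expr2 ler_piMl ?(ltW (w_gt0 x))//; case/andP: (w0 x).
Qed.

Let bound_integrable (M : R) :
  mu.-integrable setT (fun x => (2 * M * `|u x * w x| + M ^+ 2 * w x)%:E).
Proof.
apply: RintegrableD; last exact: RintegrableZ.
by apply: RintegrableZ; exact: (integrable_abse uwi).
Qed.

Let Q_integrable (h : T -> R) (M : R) : measurable_fun setT h -> (forall x, `|h x| <= M) ->
  mu.-integrable setT (EFin \o Q h).
Proof.
move=> mh hM; apply: Rintegrable_le (bound_integrable M); first exact: measurable_Q.
by move=> x; exact: Q_bound.
Qed.

(** The dominating function of [Q_bound] depends on [h] only through [M], so a uniformly bounded
    sequence passes to the limit under the integral. Measurability is carried through the same
    induction. *)
Let bpc_le (h : T -> R) : bpc A h -> measurable_fun setT h /\ \int[mu]_x Q h x <= K.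
Proof.
elim=> [p Ap|g {}h M _ IH gM gh]; first by split; [exact: A_measurable|exact: uK].
have mg j := (IH j).1.
have mh : measurable_fun setT h by apply: measurable_fun_cvg mg _ => x _; exact: gh.
split => //.
have hM x : `|h x| <= M by apply: limit_le_bound (gh x) => j; exact: gM.
have [] := @dominated_convergence _ _ _ mu setT measurableT (fun j x => (Q (g j) x)%:E)
  (EFin \o Q h) (fun x => (2 * M * `|u x * w x| + M ^+ 2 * w x)%:E).
- by move=> j; apply/measurable_EFinP; exact: measurable_Q.
- by apply/measurable_EFinP; exact: measurable_Q.
- apply: aeW => x _; apply: cvg_EFin; first exact: nearW.
  apply: cvgB.
    by apply: cvgM; [apply: cvgM; [exact: cvg_cst|exact: gh]|exact: cvg_cst].
  apply: cvgM; last exact: cvg_cst.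
  by rewrite expr2; under eq_fun do rewrite expr2; apply: cvgM; exact: gh.
- exact: bound_integrable.
- by apply: aeW => x j _; rewrite lee_fin; exact: Q_bound.
move=> _ _ L.
have fin := integrable_fin_num measurableT (Q_integrable mh hM).
rewrite -lee_fin /Rintegral fineK//.
rewrite -(cvg_lim _ L)//; apply: lime_le; first by apply/cvg_ex; eexists; exact: L.
apply: nearW => j /=.
have finj := integrable_fin_num measurableT (Q_integrable (mg j) (gM j)).
by rewrite -[leLHS]fineK// lee_fin; exact: (IH j).2.
Qed.

(* Maximising the quadratic form over [p]: the optimal choice is [p = u / w],
   truncated to be bounded. *)
Lemma l2_duality : (\int[mu]_x (u x ^+ 2)%:E <= K%:E)%E.
Proof.
(* The set where |u / w| <= j. On it the truncated optimum gives [Q] the value u^2, off it 0; the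
   sets increase to the whole space since w > 0, whence monotone convergence. *)
pose B (j : nat) := [set x | `|u x| <= j%:R * w x].
have mB j : measurable (B j).
  have mf : measurable_fun setT (fun x => j%:R * w x - `|u x|).
    by apply: measurable_funB; [exact: measurable_funM|exact: measurableT_comp].
  have := mf measurableT _ (measurable_itv `[0, +oo[).
  rewrite setTI; congr measurable; apply/seteqP; split => x /=;
    by rewrite in_itv/= andbT subr_ge0.
pose h (j : nat) x := u x / w x * \1_(B j) x.
have mh j : measurable_fun setT (h j).
  apply: measurable_funM; last exact: measurable_indic.
  apply: measurable_funM => //.
  under eq_fun do rewrite -powR_inv1 ?(ltW (w_gt0 _))//.
  exact: measurableT_comp (@measurable_powR R (-1)) mw.
have hM j x : `|h j x| <= j%:R.
  rewrite /h indicE; case: (boolP (x \in B j)) => [/[!inE] xB|_]; last by rewrite mulr0 normr0.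
  by rewrite mulr1 normf_div (gtr0_norm (w_gt0 x)) ler_pdivrMr.
have hK j : (\int[mu]_x (u x ^+ 2 * \1_(B j) x)%:E <= K%:E)%E.
  have [_ ] := bpc_le (bpc_bounded_measurable (mh j) (hM j)).
  have fin := integrable_fin_num measurableT (Q_integrable (mh j) (hM j)).
  rewrite -lee_fin /Rintegral fineK// => le; apply: le_trans le.
  rewrite le_eqVlt; apply/orP; left; apply/eqP; apply: eq_integral => x _ /=.
  congr EFin; rewrite /Q /h indicE.
  by case: (_ \in _) => /=; field; rewrite gt_eqF.
have mono := @cvg_monotone_convergence _ _ _ mu setT measurableT
  (fun j x => (u x ^+ 2 * \1_(B j) x)%:E).
have L : (\int[mu]_x (u x ^+ 2 * \1_(B j) x)%:E)%E @[j --> \oo] --> (\int[mu]_x (u x ^+ 2)%:E)%E.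
  have lx x : limn (fun j => (u x ^+ 2 * \1_(B j) x)%:E) = (u x ^+ 2)%:E.
    apply: cvg_lim => //; apply: cvg_near_cst; near=> j.
    rewrite indicE mem_set ?mulr1// /B/= -ler_pdivrMr//.
    near: j; exact: nbhs_infty_ger.
  under [X in _ --> X]eq_integral do rewrite -lx.
  apply: mono.
  - move=> j; apply/measurable_EFinP; apply: measurable_funM; first exact: measurable_funX.
    exact: measurable_indic.
  - by move=> j x _; rewrite lee_fin mulr_ge0 ?sqr_ge0.
  - move=> x _ a b ab; rewrite lee_fin ler_wpM2l ?sqr_ge0// !indicE.
    case: (boolP (x \in B a)) => [/[!inE] xB|]; last by case: (_ \in _).
    rewrite mem_set// /B/=; apply: le_trans xB _.
    by rewrite ler_wpM2r ?ler_nat// ltW.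
rewrite -(cvg_lim _ L)//; apply: lime_le; first by apply/cvg_ex; eexists; exact: L.
by apply: nearW => j; exact: hK.
Unshelve. all: end_near. Qed.

End l2_duality.

(** * Complex arithmetic and real trigonometric polynomials *)

Section trigonometric_polynomials.
Set Implicit Arguments.
Unset Strict Implicit.
Variable R : realType.
Local Notation Re := complex.Re.
Local Notation Im := complex.Im.

Lemma complex_eqP (z w : R[i]) : Re z = Re w -> Im z = Im w -> z = w.
Proof. by case: z w => [a b] [c d] /= -> ->. Qed.

Lemma ReM (z w : R[i]) : Re (z * w) = Re z * Re w - Im z * Im w.
Proof. by case: z w => [a b] [c d]. Qed.

Lemma ImM (z w : R[i]) : Im (z * w) = Re z * Im w + Im z * Re w.
Proof. by case: z w => [a b] [c d]. Qed.

Lemma ReD (z w : R[i]) : Re (z + w) = Re z + Re w.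
Proof. by case: z w => [a b] [c d]. Qed.

Lemma ImD (z w : R[i]) : Im (z + w) = Im z + Im w.
Proof. by case: z w => [a b] [c d]. Qed.

Lemma ReN (z : R[i]) : Re (- z) = - Re z. Proof. by case: z. Qed.

Lemma ImN (z : R[i]) : Im (- z) = - Im z. Proof. by case: z. Qed.

Lemma Re_sum (I : Type) (s : seq I) (F : I -> R[i]) :
  Re (\sum_(i <- s) F i) = \sum_(i <- s) Re (F i).
Proof.
by elim: s => [|i s IH]; rewrite ?big_nil// !big_cons ReD IH.
Qed.

Lemma Im_sum (I : Type) (s : seq I) (F : I -> R[i]) :
  Im (\sum_(i <- s) F i) = \sum_(i <- s) Im (F i).
Proof.
by elim: s => [|i s IH]; rewrite ?big_nil// !big_cons ImD IH.
Qed.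

Lemma normc_sqr (z : R[i]) : Normc.normc z ^+ 2 = Re z ^+ 2 + Im z ^+ 2.
Proof. by case: z => a b /=; rewrite sqr_sqrtr// addr_ge0// sqr_ge0. Qed.

Lemma normc_ge0 (z : R[i]) : 0 <= Normc.normc z.
Proof. by case: z => a b /=; exact: sqrtr_ge0. Qed.

Lemma Re_le_normc (z : R[i]) : `|Re z| <= Normc.normc z.
Proof.
by rewrite -[leLHS]sqrtr_sqr; case: z => a b /=; rewrite ler_wsqrtr// lerDl sqr_ge0.
Qed.

Lemma Im_le_normc (z : R[i]) : `|Im z| <= Normc.normc z.
Proof.
by rewrite -[leLHS]sqrtr_sqr; case: z => a b /=; rewrite ler_wsqrtr// lerDr sqr_ge0.
Qed.

Lemma normc_le_ReIm (z : R[i]) : Normc.normc z <= `|Re z| + `|Im z|.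
Proof.
rewrite -(@ler_pXn2r _ 2) ?nnegrE ?normc_ge0 ?addr_ge0// normc_sqr sqrrD.
by rewrite !real_normK ?num_real// addrAC lerDl mulrn_wge0// mulr_ge0.
Qed.

Lemma expiD (a b : R) : expi (a + b) = expi a * expi b.
Proof.
by apply: complex_eqP; rewrite ?ReM ?ImM/= ?cosD ?sinD//; ring.
Qed.

Lemma expi0 : expi (0 : R) = 1.
Proof. by apply: complex_eqP; rewrite /= ?cos0 ?sin0. Qed.

Lemma normc_expi (a : R) : Normc.normc (expi a) = 1.
Proof. by rewrite /= cos2Dsin2 sqrtr1. Qed.

Variable n : nat.
Local Notation V := ('rV[R]_n).

(** The function is real but the expansion complex: each exponential has to be matched with one
    translated Gaussian, and the conjugation symmetry of the coefficients is left implicit in the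
    equation. *)
Definition trig (p : V -> R) : Prop := exists s : seq (R[i] * V),
  forall x, ((p x)%:C)%C = \sum_(z <- s) z.1 * expi (dot z.2 x).

Lemma trigE (p : V -> R) (s : seq (R[i] * V)) :
  (forall x, ((p x)%:C)%C = \sum_(z <- s) z.1 * expi (dot z.2 x)) ->
  forall x, p x = \sum_(z <- s) (Re z.1 * cos (dot z.2 x) - Im z.1 * sin (dot z.2 x)).
Proof.
move=> H x; rewrite -[LHS]/(Re (p x)%:C%C) H Re_sum.
by apply: eq_bigr => z _; rewrite ReM.
Qed.

Lemma trig_bounded p : trig p -> exists M, forall x, `|p x| <= M.
Proof.
move=> [s H]; exists (\sum_(z <- s) (`|Re z.1| + `|Im z.1|)) => x.
rewrite (trigE H); apply: le_trans (ler_norm_sum _ _ _) _; apply: ler_sum => z _.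
apply: le_trans (ler_normB _ _) _; rewrite !normrM.
by apply: lerD; apply: ler_piMr => //; [exact: cos_max|exact: sin_max].
Qed.

Lemma trig_measurable p : trig p -> measurable_fun setT p.
Proof.
move=> [s H]; rewrite (funext (trigE H)); apply: measurable_sum => z.
apply: measurable_funB; apply: measurable_funM => //.
  exact: measurableT_comp (@measurable_cosR R) (measurable_dot z.2).
exact: measurableT_comp (@measurable_sinR R) (measurable_dot z.2).
Qed.

Lemma trig_cst c : trig (fun=> c).
Proof.
exists [:: (c%:C%C, 0)] => x; rewrite big_seq1 dot0l expi0 mulr1//.
Qed.

Lemma trigD p q : trig p -> trig q -> trig (fun x => p x + q x).
Proof.
move=> [s Hs] [t Ht]; exists (s ++ t) => x.
by rewrite big_cat/= -Hs -Ht rmorphD.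
Qed.

Lemma trigM p q : trig p -> trig q -> trig (fun x => p x * q x).
Proof.
move=> [s Hs] [t Ht].
exists [seq (z.1 * w.1, z.2 + w.2) | z <- s, w <- t] => x.
have -> : ((p x * q x)%:C = (p x)%:C * (q x)%:C)%C by exact: rmorphM.
rewrite big_allpairs_dep Hs Ht mulr_suml; apply: eq_bigr => z _.
rewrite mulr_sumr; apply: eq_bigr => w _ /=.
by rewrite dotDl expiD; ring.
Qed.

Lemma trig_cos (m : V) k : trig (fun x => cos (dot m x + k)).
Proof.
exists [:: ((cos k / 2 +i* (sin k / 2))%C, m); ((cos k / 2 -i* (sin k / 2))%C, - m)] => x.
rewrite big_cons big_seq1 /= dotNl.
apply: complex_eqP; rewrite ?ReD ?ImD ?ReM ?ImM/= cosN sinN.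
  by rewrite cosD; field.
by field.
Qed.

(** A coordinate is unbounded, so it is replaced by the dilated sine of (x_i - c) / (j + 1), which
    has the sign of x_i - c as soon as |x_i - c| < j + 1, because 1 < pi. The positivity indicator
    of these sines is therefore eventually the right one at each point. *)
Lemma bpc_coord_gt (i : 'I_n) (c : R) :
  bpc trig (\1_((fun x : V => x 0 i) @^-1` `]c, +oo[%classic)).
Proof.
pose si (j : nat) (x : V) := sin ((x 0 i - c) / j.+1%:R).
have bsi j : bpc trig (si j).
  apply: bpc_base; rewrite (_ : si j = fun x =>
      cos (dot (j.+1%:R^-1 *: delta_mx 0 i) x + (- c / j.+1%:R - pi / 2))); first exact: trig_cos.
  apply/funext => x; rewrite /si dotZl (_ : dot _ _ = x 0 i); last first.
    rewrite /dot (bigD1 i)//= mxE !eqxx mul1r big1 ?addr0// => k ki.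
    by rewrite mxE eqxx/= (negbTE ki) mul0r.
  rewrite addrA cosBpihalf; congr sin; rewrite mulrDl mulrC.
  by [].
apply: (@bpc_lim _ _ _ (fun j x => (((0 < si j x)%R)%:R)) _ 1).
- move=> j; apply: bpc_gt0 => //; [exact: trig_bounded|exact: trig_cst|exact: trigD|exact: trigM].
- by move=> j x; case: (_ < _); rewrite ?normr1 ?normr0.
- move=> x; apply: cvg_near_cst; near=> j.
  rewrite indicE; congr (nat_of_bool _)%:R.
  have h : `|x 0 i - c| < j.+1%:R.
    apply: lt_trans (_ : j%:R < _); last by rewrite ltr_nat.
    near: j; exact: nbhs_infty_gtr.
  have j0 : 0 < j.+1%:R :> R by rewrite ltr0Sn.
  move: h; rewrite ltr_norml => /andP[h1 h2].
  have pi1 : 1 < pi :> R by have := @pi_ge2 R; lra.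
  apply/idP/idP.
    rewrite /si => s0; rewrite inE /= in_itv/= andbT ltNge; apply/negP => xc.
    have : 0 <= sin (- ((x 0 i - c) / j.+1%:R)).
      apply: sin_ge0_pi; rewrite -mulNr divr_ge0 ?ler0n//=; last lra.
      by rewrite ler_pdivrMr//; nra.
    by rewrite sinN oppr_ge0 leNgt s0.
  rewrite inE /= in_itv/= andbT => xc; apply: sin_gt0_pi.
  by rewrite divr_gt0 ?subr_gt0//= ltr_pdivrMr//; nra.
Unshelve. all: end_near. Qed.

(** The sets with indicator in the closure form a sigma-algebra; it contains the preimages of open
    rays under coordinates, and these generate. *)
Lemma bpc_trig_indic (B : set V) : measurable B -> bpc trig (\1_B).
Proof.
have sig := bpc_sigma_algebra trig_bounded trig_cst trigD trigM.
suff : measurable `<=` [set B : set V | bpc trig (\1_B)] by apply.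
apply: smallest_sub; first exact: sig.
rewrite -bigcup_seq => _ [i /= _ [C mC <-]]; rewrite setTI /=.
suff : measurable `<=` [set C : set R | bpc trig (\1_((fun x : V => x 0 i) @^-1` C))] by apply.
rewrite [X in X `<=` _]RGenOInfty.measurableE; apply: smallest_sub.
  have [s0 sC sU] := sig.
  split => /=.
  - by rewrite preimage_set0.
  - by move=> D mD; rewrite setTD preimage_setC -setTD; exact: sC.
  - by move=> F mF; rewrite preimage_bigcup; exact: sU.
by move=> _ [c ->]; exact: bpc_coord_gt.
Qed.

End trigonometric_polynomials.

(** * Schwartz functions of Gaussian type *)

Section schwartz_gaussians.
Set Implicit Arguments.
Unset Strict Implicit.
Variables (R : realType) (n : nat).
Local Notation V := ('rV[R]_n).

(** The directional difference quotient at [x] coincides with that of the restriction to the line at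
    0, so the one-variable rules become available. *)
Lemma is_derive_line (f : V -> R) (x v : V) (df : R) :
  is_derive (0 : R) (1 : R) (fun h => f (x + h *: v)) df -> is_derive x v f df.
Proof.
have E : (fun h : R => h^-1 *: ((f \o shift x) (h *: v) - f x)) =
    (fun h : R => h^-1 *: (((fun h => f (x + h *: v)) \o shift 0) (h *: (1 : R)) - f (x + 0 *: v))).
  apply/funext => h /=; rewrite scale0r !addr0; congr (_ *: (f _ - _)).
  by rewrite addrC /GRing.scale/= ?addr0 mulr1.
move=> [d1 d2]; apply: DeriveDef.
  by move: d1; rewrite /derivable -E.
by rewrite -d2 /derive E.
Qed.

(** The prefactors of a Gaussian that can arise from modulation, differentiation and multiplication
    by monomials. The class is stable under derivatives and grows more slowly than any exp (e
    |x|^2). *)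
Inductive tame : (V -> R) -> Prop :=
| tame_cst c : tame (fun=> c)
| tame_coord i : tame (fun x => x 0 i)
| tame_cos m k : tame (fun x => cos (dot m x + k))
| tame_add p q : tame p -> tame q -> tame (fun x => p x + q x)
| tame_mul p q : tame p -> tame q -> tame (fun x => p x * q x).

Lemma tame_derive (v : V) p : tame p ->
  exists2 q, tame q & forall x, is_derive x v p (q x).
Proof.
elim=> [c|i|m k|{}p q _ [p' tp dp] _ [q' tq dq]|{}p q tp [p' tp' dp] tq [q' tq' dq]].
- by exists (fun=> 0); [exact: tame_cst|move=> x; exact: is_derive_cst].
- exists (fun=> v 0 i); first exact: tame_cst.
  move=> x; apply: is_derive_line; under eq_fun do rewrite !mxE.
  by apply: is_derive_eq; rewrite /GRing.scale/= mulr1; ring.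
(* The sine is a cosine with phase shifted by pi/2, so the derivative stays in the class. *)
- exists (fun x => - dot m v * cos (dot m x + (k - pi / 2))).
    exact: tame_mul (tame_cst _) (tame_cos _ _).
  move=> x; apply: is_derive_line.
  rewrite (_ : (fun h => _) = fun h => cos (dot m v * h + (dot m x + k))).
    apply: is_derive_eq (is_derive_cos_affine _ _ _) _.
    by rewrite mulr0 add0r addrA cosBpihalf mulNr.
  by apply/funext => h; rewrite dotDr dotZr; congr cos; ring.
- exists (fun x => p' x + q' x); first exact: tame_add.
  by move=> x; have := dp x; have := dq x => hq hp; exact: is_deriveD.
- exists (fun x => p x * q' x + q x * p' x).
    by apply: tame_add; exact: tame_mul.
  by move=> x; have := dp x; have := dq x => hq hp; exact: is_deriveM.
Qed.

Lemma continuous_coord (i : 'I_n) : continuous (fun x : V => x 0 i).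
Proof. by move=> x; exact: coord_continuous. Qed.

Lemma continuous_addr (T : topologicalType) (f g : T -> R) :
  continuous f -> continuous g -> continuous (fun x => f x + g x).
Proof. by move=> cf cg x; apply: cvgD; [exact: cf|exact: cg]. Qed.

Lemma continuous_mulr (T : topologicalType) (f g : T -> R) :
  continuous f -> continuous g -> continuous (fun x => f x * g x).
Proof. by move=> cf cg x; apply: cvgM; [exact: cf|exact: cg]. Qed.

Lemma continuous_compr (T : topologicalType) (f : T -> R) (h : R -> R) :
  continuous f -> continuous h -> continuous (fun x => h (f x)).
Proof. by move=> cf ch x; apply: (continuous_comp (cf x)); exact: ch. Qed.

Lemma continuous_sumr (T : topologicalType) (I : Type) (s : seq I) (F : I -> T -> R) :
  (forall i, continuous (F i)) -> continuous (fun x => \sum_(i <- s) F i x).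
Proof.
move=> cF; elim: s => [|i s IH].
  rewrite (_ : (fun x => _) = cst 0); first exact: cst_continuous.
  by apply/funext => y; rewrite big_nil.
rewrite (_ : (fun x => _) = fun y => F i y + \sum_(j <- s) F j y).
  exact: continuous_addr.
by apply/funext => y; rewrite big_cons.
Qed.

Lemma continuous_dot (m : V) : continuous (dot m).
Proof.
apply: continuous_sumr => i; apply: continuous_mulr; first exact: cst_continuous.
exact: continuous_coord.
Qed.

Lemma tame_continuous p : tame p -> continuous p.
Proof.
elim=> [c|i|m k|{}p q _ cp _ cq|{}p q _ cp _ cq].
- exact: cst_continuous.
- exact: continuous_coord.
- apply: (@continuous_compr _ (fun x => dot m x + k) cos); last exact: continuous_cos.
  by apply: continuous_addr; [exact: continuous_dot|exact: cst_continuous].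
- exact: continuous_addr.
- exact: continuous_mulr.
Qed.

Lemma coord_sqr_le (x : V) i : x 0 i ^+ 2 <= dot x x.
Proof.
rewrite /dot (bigD1 i)//= -expr2 lerDl; apply: sumr_ge0 => j _.
by rewrite -expr2 sqr_ge0.
Qed.

(** The rate [e] is quantified inside the induction because a product spends e/2 on each factor. *)
Lemma tame_growth p : tame p -> forall e : R, 0 < e ->
  exists C, forall x, `|p x| <= C * expR (e * dot x x).
Proof.
have e1 (e : R) (x : V) : 0 < e -> 1 <= expR (e * dot x x).
  by move=> e0; rewrite -[leLHS]expR0 ler_expR mulr_ge0 ?dotxx_ge0// ltW.
elim=> [c|i|m k|{}p q _ IHp _ IHq|{}p q _ IHp _ IHq] e e0.
- by exists `|c| => x; rewrite ler_peMr// e1.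
(* Chosen so that its product with [1 + e * dot x x] contains [1 + dot x x], which dominates
   |x_i|. *)
- exists (1 + e^-1) => x.
  apply: le_trans (_ : (1 + e^-1) * (1 + e * dot x x) <= _); last first.
    by rewrite ler_wpM2l ?expR_ge1Dx// addr_ge0// invr_ge0 ltW.
  have -> : (1 + e^-1) * (1 + e * dot x x) = (1 + dot x x) + (e^-1 + e * dot x x).
    by field; rewrite gt_eqF.
  have h1 : 0 <= e^-1 + e * dot x x.
    by rewrite addr_ge0 ?invr_ge0 ?mulr_ge0 ?dotxx_ge0// ltW.
  have h2 : `|x 0 i| <= 1 + x 0 i ^+ 2.
    by rewrite -[x 0 i ^+ 2]real_normK ?num_real//; have := normr_ge0 (x 0 i);
      set z := `|_|; nra.
  have := coord_sqr_le x i; lra.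
- exists 1 => x; rewrite mul1r; apply: le_trans (e1 e x e0); exact: cos_max.
- have [C hC] := IHp e e0; have [D hD] := IHq e e0.
  exists (C + D) => x; apply: le_trans (ler_normD _ _) _; rewrite mulrDl.
  exact: lerD.
- have e20 : 0 < e / 2 by rewrite divr_gt0.
  have [C hC] := IHp _ e20; have [D hD] := IHq _ e20.
  exists (C * D) => x; rewrite normrM.
  have -> : e * dot x x = e / 2 * dot x x + e / 2 * dot x x by field.
  by rewrite expRD mulrACA; apply: ler_pM.
Qed.

Variables (c : R) (b : V).
Hypothesis c0 : 0 < c.

Lemma tame_gaussn_bounded p : tame p ->
  exists M, forall x, `|p x * gaussn c b x| <= M.
Proof.
move=> tp; have c20 : 0 < c / 2 by rewrite divr_gt0.
have [C hC] := tame_growth tp c20.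
exists (C * expR (c * dot b b)) => x.
rewrite normrM (ger0_norm (gaussn_ge0 _ _ _)).
apply: le_trans (_ : C * expR (c / 2 * dot x x) * gaussn c b x <= _).
  by rewrite ler_wpM2r ?gaussn_ge0.
have C0 : 0 <= C.
  by have := le_trans (normr_ge0 _) (hC 0); rewrite pmulr_lge0 ?expR_gt0.
rewrite -mulrA ler_wpM2l// /gaussn -expRD ler_expR.
(* Completing the square: c |b|^2 - (c/2 |x|^2 - c |x - b|^2) = c/2 |x - 2b|^2. *)
have := dotxx_ge0 (x - 2 *: b).
rewrite !(dotDl, dotDr, dotNl, dotNr, dotZl, dotZr) (dotC b x).
move: (dot x x) (dot x b) (dot b b) => X Y Z; nra.
Qed.

Lemma gaussn_derive (v x : V) :
  is_derive x v (gaussn c b) (- (2 * c * dot v (x - b)) * gaussn c b x).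
Proof.
apply: is_derive_line.
have E h : gaussn c b (x + h *: v) =
    expR (- (c * dot (x - b) (x - b)) + (- (2 * c * dot v (x - b)) * h - c * dot v v * h ^+ 2)).
  rewrite /gaussn addrAC; move: (x - b) => y; congr expR.
  rewrite !(dotDl, dotDr, dotZl, dotZr) (dotC y v); ring.
under eq_fun do rewrite E.
have h : is_derive (0 : R) (1 : R) (fun h => - (c * dot (x - b) (x - b)) +
    (- (2 * c * dot v (x - b)) * h - c * dot v v * h ^+ 2)) (- (2 * c * dot v (x - b))).
  by apply: is_derive_eq; rewrite /GRing.scale/=; ring.
apply: is_derive_eq (is_derive1_comp (is_derive_expR _) h) _.
by rewrite mulr0 expr0n/= mulr0 subrr addr0 mulrC.
Qed.

Lemma continuous_gaussn : continuous (gaussn c b).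
Proof.
rewrite (_ : gaussn c b = fun x => expR (- c * dot (x - b) (x - b))); last first.
  by apply/funext => x; rewrite mulNr.
have cc i : continuous (fun x : V => (x - b) 0 i).
  under eq_fun do rewrite !mxE.
  by apply: continuous_addr; [exact: continuous_coord|exact: cst_continuous].
have cd : continuous (fun x : V => dot (x - b) (x - b)).
  apply: (@continuous_sumr 'rV[R]_n _ (index_enum 'I_n) (fun i x => (x - b) 0 i * (x - b) 0 i)) => i.
  exact: continuous_mulr.
apply: continuous_compr (@continuous_expR R).
by apply: continuous_mulr; first exact: cst_continuous.
Qed.

Definition tame_gauss (g : V -> R) : Prop :=
  exists2 p, tame p & g = fun x => p x * gaussn c b x.

Lemma tame_dot v : tame (dot v).
Proof.
rewrite (_ : dot v = fun x => \sum_(i <- index_enum 'I_n) v 0 i * x 0 i)//.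
elim: (index_enum _) => [|i s IH].
  by under eq_fun do rewrite big_nil; exact: tame_cst.
under eq_fun do rewrite big_cons.
apply: tame_add => //; apply: tame_mul; [exact: tame_cst|exact: tame_coord].
Qed.

Lemma tame_gauss_derive v g : tame_gauss g ->
  exists2 g', tame_gauss g' & forall x, is_derive x v g (g' x).
Proof.
move=> [p tp ->]; have [q tq dq] := tame_derive v tp.
exists (fun x => (q x + p x * (- (2 * c) * (dot v x + (- dot v b)))) * gaussn c b x).
  exists (fun x => q x + p x * (- (2 * c) * (dot v x + (- dot v b)))) => //.
  apply: tame_add => //; apply: tame_mul => //; apply: tame_mul; first exact: tame_cst.
  by apply: tame_add; [exact: tame_dot|exact: tame_cst].
move=> x; have h1 := dq x; have h2 := gaussn_derive v x.
apply: is_derive_eq (is_deriveM h1 h2) _.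
by rewrite /GRing.scale/= dotDr dotNr; ring.
Qed.

Lemma tame_gauss_partials s g : tame_gauss g -> tame_gauss (partials s g).
Proof.
move=> tg; elim: s => [//|i s IH] /=.
have [g' tg' dg'] := tame_gauss_derive (delta_mx 0 i) IH.
rewrite (_ : partial _ _ = g')//; apply/funext => x.
by rewrite /partial; have [_] := dg' x.
Qed.

Lemma tame_gauss_smooth g : tame_gauss g -> smooth g.
Proof.
move=> tg s; have ts := tame_gauss_partials s tg; split.
  have [p tp ->] := ts; apply: continuous_mulr; first exact: tame_continuous.
  exact: continuous_gaussn.
move=> x i; have [g' _ dg'] := tame_gauss_derive (delta_mx 0 i) ts.
by have [] := dg' x.
Qed.

(** A monomial times a mixed derivative is again a tame function times the same Gaussian, hence
    bounded. *)
Lemma tame_gauss_schwartz (f : V -> R[i]) :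
  tame_gauss (fun x => complex.Re (f x)) -> tame_gauss (fun x => complex.Im (f x)) ->
  schwartz f.
Proof.
move=> tr ti; split; [exact: tame_gauss_smooth|exact: tame_gauss_smooth|].
move=> al s.
have [p tp Ep] := tame_gauss_partials s tr.
have [q tq Eq] := tame_gauss_partials s ti.
pose m (x : V) := \prod_(i < n) x 0 i ^+ al i.
have tm : tame m.
  rewrite /m; elim: (index_enum _) => [|i t IH].
    by under eq_fun do rewrite big_nil; exact: tame_cst.
  under eq_fun do rewrite big_cons.
  apply: tame_mul => //; elim: (al i) => [|k IHk]; first exact: tame_cst.
  by under eq_fun do rewrite exprS; apply: tame_mul => //; exact: tame_coord.
have [M hM] := tame_gaussn_bounded (tame_mul tm tp).
have [N hN] := tame_gaussn_bounded (tame_mul tm tq).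
exists (M + N) => x; rewrite /weighted /cpartials Ep Eq.
apply: le_trans (normc_le_ReIm _) _.
rewrite ReM ImM/= !mul0r subr0 addr0 !mulrA.
exact: lerD (hM x) (hN x).
Qed.

End schwartz_gaussians.

(** * The Plancherel inequality *)

Section plancherel.
Set Implicit Arguments.
Unset Strict Implicit.
Variables (R : realType) (n : nat).
Local Notation V := ('rV[R]_n).
Local Notation leb := (@lebesgue_rV R n).
Local Notation Re := complex.Re.
Local Notation Im := complex.Im.

Lemma cintegrableD (f g : V -> R[i]) : cintegrable f -> cintegrable g ->
  cintegrable (fun x => f x + g x).
Proof.
move=> [f1 f2] [g1 g2]; split.
  by under eq_fun do rewrite ReD; exact: RintegrableD.
by under eq_fun do rewrite ImD; exact: RintegrableD.
Qed.

Lemma cintegralD (f g : V -> R[i]) : cintegrable f -> cintegrable g ->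
  cintegral (fun x => f x + g x) = cintegral f + cintegral g.
Proof.
move=> [f1 f2] [g1 g2]; apply: complex_eqP; rewrite ?ReD ?ImD /=.
  by under eq_Rintegral do rewrite ReD; rewrite RintegralD.
by under eq_Rintegral do rewrite ImD; rewrite RintegralD.
Qed.

Lemma cintegrableZ (c : R[i]) (f : V -> R[i]) : cintegrable f ->
  cintegrable (fun x => c * f x).
Proof.
move=> [f1 f2]; split.
  by under eq_fun do rewrite ReM; apply: RintegrableB; exact: RintegrableZ.
by under eq_fun do rewrite ImM; apply: RintegrableD; exact: RintegrableZ.
Qed.

Lemma cintegralZ (c : R[i]) (f : V -> R[i]) : cintegrable f ->
  cintegral (fun x => c * f x) = c * cintegral f.
Proof.
move=> [f1 f2]; apply: complex_eqP; rewrite ?ReM ?ImM /=.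
  under eq_Rintegral do rewrite ReM.
  rewrite RintegralB//; [|exact: RintegrableZ|exact: RintegrableZ].
  by rewrite !RintegralZl.
under eq_Rintegral do rewrite ImM.
rewrite RintegralD//; [|exact: RintegrableZ|exact: RintegrableZ].
by rewrite !RintegralZl.
Qed.

Lemma cintegrableB (f g : V -> R[i]) : cintegrable f -> cintegrable g ->
  cintegrable (fun x => f x - g x).
Proof.
move=> fi gi; under eq_fun do rewrite -mulN1r.
by apply: cintegrableD => //; exact: cintegrableZ.
Qed.

Lemma cintegralB (f g : V -> R[i]) : cintegrable f -> cintegrable g ->
  cintegral (fun x => f x - g x) = cintegral f - cintegral g.
Proof.
move=> fi gi; rewrite -mulN1r -cintegralZ// -cintegralD//; last exact: cintegrableZ.
by congr cintegral; apply/funext => x; rewrite mulN1r.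
Qed.

Lemma cintegral0 : cintegral (fun _ : V => 0) = 0.
Proof. by apply: complex_eqP; rewrite /= /Rintegral integral0. Qed.

Lemma cintegrable0 : cintegrable (fun _ : V => 0).
Proof. by split; exact: integrable0. Qed.

Lemma cintegrable_sum (I : Type) (s : seq I) (F : I -> V -> R[i]) :
  (forall i, cintegrable (F i)) -> cintegrable (fun x => \sum_(i <- s) F i x).
Proof.
move=> Fi; elim: s => [|i s IH].
  by under eq_fun do rewrite big_nil; exact: cintegrable0.
by under eq_fun do rewrite big_cons; exact: cintegrableD.
Qed.

Lemma cintegral_sum (I : Type) (s : seq I) (F : I -> V -> R[i]) :
  (forall i, cintegrable (F i)) ->
  cintegral (fun x => \sum_(i <- s) F i x) = \sum_(i <- s) cintegral (F i).
Proof.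
move=> Fi; elim: s => [|i s IH].
  by under eq_fun do rewrite big_nil; rewrite big_nil cintegral0.
under eq_fun do rewrite big_cons.
by rewrite big_cons cintegralD// ?IH//; exact: cintegrable_sum.
Qed.

Let h0 : 0 < (2^-1 : R). Proof. by rewrite invr_gt0. Qed.

(** The rate 1/2 is self-dual: translation by [m] becomes a character in front of the same Gaussian
    centred at 0. *)
Definition gphi (m : V) (x : V) : R[i] := ((gaussn 2^-1 m x)%:C)%C.
(* [gcst ^+ 2 = (2 * pi) ^+ n] *)
Definition gcst : R := Num.sqrt (pi / 2^-1) ^+ n.

Lemma gcst_gt0 : 0 < gcst.
Proof. by rewrite exprn_gt0// sqrtr_gt0 divr_gt0// pi_gt0. Qed.

Lemma fourier_gphi (m : V) :
  fourier (gphi m) = fun x => ((gcst * gaussn 2^-1 0 x)%:C)%C * expi (- dot x m).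
Proof.
apply/funext => x.
(* Phase 0 gives the real part, phase - pi/2 the imaginary part. *)
have E (k : R) : \int[leb]_y (cos (dot (- x) y + k) * gaussn 2^-1 m y) =
    gcst * gaussn 2^-1 0 x * cos (- dot x m + k).
  rewrite cos_gaussn_integral// dotNl /gaussn subr0 dotNl dotNr opprK -/gcst.
  have -> : - (dot x x / (4 / 2)) = - (2^-1 * dot x x) by field.
  ring.
apply: complex_eqP; rewrite ?ReM ?ImM /=.
  rewrite mul0r subr0 -[in RHS](addr0 (- dot x m)) -E; apply: eq_Rintegral => y _.
  by rewrite ?ReM/= mulr0 subr0 dotNl addr0.
rewrite mul0r addr0 -[sin _]cosBpihalf -E; apply: eq_Rintegral => y _.
by rewrite ?ImM/= mulr0 add0r dotNl cosBpihalf.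
Qed.

Lemma tame_gauss_cos (c : R) (b : V) (k : R) (m : V) (l : R) :
  tame_gauss c b (fun x => k * gaussn c b x * cos (dot m x + l)).
Proof.
exists (fun x => k * cos (dot m x + l)).
  by apply: tame_mul; [exact: tame_cst|exact: tame_cos].
by apply/funext => x; rewrite mulrAC.
Qed.

Lemma schwartz_gphi (m : V) : schwartz (gphi m).
Proof.
apply: (@tame_gauss_schwartz _ _ 2^-1 m h0).
  exists (fun=> 1); first exact: tame_cst.
  by apply/funext => x; rewrite mul1r.
exists (fun=> 0); first exact: tame_cst.
by apply/funext => x; rewrite mul0r.
Qed.

Lemma schwartz_fourier_gphi (m : V) : schwartz (fourier (gphi m)).
Proof.
rewrite fourier_gphi; apply: (@tame_gauss_schwartz _ _ 2^-1 0 h0).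
  rewrite (_ : (fun x => _) = fun x => gcst * gaussn 2^-1 0 x * cos (dot (- m) x + 0)).
    exact: tame_gauss_cos.
  by apply/funext => x; rewrite ReM/= mul0r subr0 addr0 dotNl dotC.
rewrite (_ : (fun x => _) = fun x => gcst * gaussn 2^-1 0 x * cos (dot (- m) x + (- (pi / 2)))).
  exact: tame_gauss_cos.
by apply/funext => x; rewrite ImM/= mul0r addr0 dotNl dotC cosBpihalf.
Qed.

Lemma gaussn_le1 c (b x : V) : 0 < c -> gaussn c b x <= 1.
Proof.
by move=> c0; rewrite -[leRHS]expR0 ler_expR oppr_le0 mulr_ge0 ?dotxx_ge0// ltW.
Qed.

(** The parallelogram law around the midpoint of [a] and [b]. The factor exp (- |a - b|^2 / 4) is
    the entry of the Gram matrix, up to normalisation. *)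
Lemma gaussn_mul (a b x : V) : gaussn 2^-1 a x * gaussn 2^-1 b x =
  expR (- (dot (a - b) (a - b) / 4)) * gaussn 1 (2^-1 *: (a + b)) x.
Proof.
rewrite /gaussn -!expRD; congr expR.
rewrite !(dotDl, dotDr, dotNl, dotNr, dotZl, dotZr) (dotC b a) (dotC a x) (dotC b x).
by field.
Qed.

Lemma gaussn_sqr (x : V) : gaussn 2^-1 0 x ^+ 2 = gaussn 1 0 x.
Proof.
rewrite expr2 gaussn_mul subrr dot0l mul0r oppr0 expR0 mul1r.
by rewrite addr0 scaler0.
Qed.

Lemma gaussn1_integral (b : V) : \int[leb]_x gaussn 1 b x = Num.sqrt pi ^+ n.
Proof.
have := cos_gaussn_integral b 0 0 (ltr01 : 0 < (1 : R)).
rewrite dot0l add0r cos0 mul1r dot0l mul0r oppr0 expR0 mul1r divr1 => <-.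
by apply: eq_Rintegral => x _; rewrite dot0l add0r cos0 mul1r.
Qed.

Section gram.
Variable s : seq (R[i] * V).
(** The sign is such that the Fourier transform of [gphi (- m)] carries the character
    [expi (dot m x)]: that of [Phi] is [gcst] times [P] times the Gaussian. *)
Let Phi (x : V) : R[i] := \sum_(z <- s) z.1 * gphi (- z.2) x.
Let P (x : V) : R[i] := \sum_(z <- s) z.1 * expi (dot z.2 x).

(** [D] and [E] are the real and imaginary parts of [z.1] times the conjugate of [w.1]. *)
Let D (z w : R[i] * V) : R := Re z.1 * Re w.1 + Im z.1 * Im w.1.
Let E (z w : R[i] * V) : R := Im z.1 * Re w.1 - Re z.1 * Im w.1.

Let PhiE x : Normc.normc (Phi x) ^+ 2 = \sum_(z <- s) \sum_(w <- s)
  D z w * expR (- (dot (z.2 - w.2) (z.2 - w.2) / 4)) * gaussn 1 (2^-1 *: (- z.2 - w.2)) x.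
Proof.
rewrite normc_sqr /Phi Re_sum Im_sum !expr2 !mulr_suml -big_split; apply: eq_bigr => z _ /=.
rewrite !mulr_sumr -big_split; apply: eq_bigr => w _ /=.
rewrite !ReM !ImM/= !mulr0 !subr0 !add0r.
have -> : dot (z.2 - w.2) (z.2 - w.2) = dot (- z.2 - - w.2) (- z.2 - - w.2).
  by rewrite -opprD dotNl dotNr opprK.
by rewrite -[RHS]mulrA -(gaussn_mul (- z.2) (- w.2) x) /D; ring.
Qed.

Let PE x : Normc.normc (P x) ^+ 2 * gaussn 2^-1 0 x ^+ 2 = \sum_(z <- s) \sum_(w <- s)
  (D z w * (cos (dot (z.2 - w.2) x + 0) * gaussn 1 0 x) +
   - E z w * (cos (dot (z.2 - w.2) x + - (pi / 2)) * gaussn 1 0 x)).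
Proof.
rewrite gaussn_sqr normc_sqr /P Re_sum Im_sum !expr2 !mulr_suml -big_split mulr_suml.
apply: eq_bigr => z _ /=.
rewrite !mulr_sumr -big_split mulr_suml; apply: eq_bigr => w _ /=.
rewrite !ReM !ImM/= addr0 cosBpihalf dotDl dotNl cosD sinD cosN sinN /D /E; ring.
Qed.

(** Entry by entry, the overlap of two translates at distance |d| and the transform of the squared
    Gaussian at frequency d are both exp (- |d|^2 / 4) pi^(n/2). The sine terms integrate to 0
    because the Gaussian is centred at 0. *)
Lemma gram : \int[leb]_x (Normc.normc (Phi x) ^+ 2) =
  \int[leb]_x (Normc.normc (P x) ^+ 2 * gaussn 2^-1 0 x ^+ 2).
Proof.
under eq_Rintegral do rewrite PhiE.
under [RHS]eq_Rintegral do rewrite PE.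
have c1 : 0 < 1 :> R by [].
rewrite !Rintegral_sum; last 2 first.
  move=> z; apply: Rintegrable_sum => w; apply: RintegrableD; apply: RintegrableZ;
    exact: cos_gaussn_integrable.
  move=> z; apply: Rintegrable_sum => w; apply: RintegrableZ; exact: gaussn_integrable.
apply: eq_bigr => z _; rewrite !Rintegral_sum; last 2 first.
  move=> w; apply: RintegrableD; apply: RintegrableZ; exact: cos_gaussn_integrable.
  move=> w; apply: RintegrableZ; exact: gaussn_integrable.
apply: eq_bigr => w _.
rewrite RintegralZl//; last exact: gaussn_integrable.
rewrite RintegralD//; [|apply: RintegrableZ; exact: cos_gaussn_integrable..].
rewrite !RintegralZl//; [|exact: cos_gaussn_integrable..].
rewrite !cos_gaussn_integral// gaussn1_integral dotC dot0l !add0r cos0 cosN cos_pihalf.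
by rewrite !mul0r mulr0 addr0 mul1r mulr1 divr1 mulrA.
Qed.

Lemma Phi_sqr_integrable : leb.-integrable setT (fun x => (Normc.normc (Phi x) ^+ 2)%:E).
Proof.
under eq_fun do rewrite PhiE.
apply: Rintegrable_sum => z; apply: Rintegrable_sum => w; apply: RintegrableZ.
exact: gaussn_integrable.
Qed.

Lemma P_sqr_integrable : leb.-integrable setT
  (fun x => (Normc.normc (P x) ^+ 2 * gaussn 2^-1 0 x ^+ 2)%:E).
Proof.
under eq_fun do rewrite PE.
apply: Rintegrable_sum => z; apply: Rintegrable_sum => w.
by apply: RintegrableD; apply: RintegrableZ; exact: cos_gaussn_integrable.
Qed.

End gram.

Variables (w G : V -> R[i]) (K : R).
Hypothesis mw : cmeasurable w.
Hypothesis mG : cmeasurable G.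
Hypothesis wi : forall m, cintegrable (fun x => w x * fourier (gphi m) x).
Hypothesis Gi : forall m, cintegrable (fun x => G x * gphi m x).
Hypothesis wG : forall m,
  cintegral (fun x => w x * fourier (gphi m) x) = cintegral (fun x => G x * gphi m x).
Hypothesis GK : (\int[leb]_x (Normc.normc (G x) ^+ 2)%:E <= K%:E)%E.

Lemma measurable_normc_sqr (f : V -> R[i]) : cmeasurable f ->
  measurable_fun setT (fun x => Normc.normc (f x) ^+ 2).
Proof.
move=> [m1 m2]; under eq_fun do rewrite normc_sqr.
by apply: measurable_funD; exact: measurable_funX.
Qed.

(* Testing against the trigonometric polynomial [p] times a Gaussian amounts to
   testing [G] against a combination [Phi] of translated Gaussians, and [gram]
   says that this correspondence is isometric up to the constant. *)
Lemma plancherel_Re : (\int[leb]_x (Re (w x) ^+ 2)%:E <= (gcst ^- 2 * K)%:E)%E.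
Proof.
have g0 := gcst_gt0.
have iG : leb.-integrable setT (fun x => (Normc.normc (G x) ^+ 2)%:E).
  apply/integrableP; split.
    by apply/measurable_EFinP; exact: (measurable_normc_sqr mG).
  under eq_integral do rewrite gee0_abs ?lee_fin ?sqr_ge0//.
  exact: le_lt_trans GK (ltry _).
apply: (@l2_duality _ _ _ leb (@trig R n) (@trig_bounded R n) (@trig_cst R n)
  (@trigD R n) (@trigM R n) (@trig_measurable R n) (@bpc_trig_indic R n)
  _ (gaussn 2^-1 0)).
- exact: mw.1.
- exact: measurable_gaussn.
- by move=> x; rewrite expR_gt0 gaussn_le1.
- exact: gaussn_integrable.
(* For m = 0 the transform is the real Gaussian times [gcst], so its pairing with [w] controls
   [Re w] times the Gaussian. *)
- have [h _] := cintegrableZ ((gcst^-1)%:C)%C (wi 0).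
  apply: eq_integrable h => // x _; congr EFin.
  rewrite fourier_gphi dotC dot0l oppr0 expi0 mulr1 !ReM ImM/=.
  by field; rewrite gt_eqF.
move=> p [s ps].
pose Phi (x : V) : R[i] := \sum_(z <- s) z.1 * gphi (- z.2) x.
have pE x : Normc.normc (\sum_(z <- s) z.1 * expi (dot z.2 x)) ^+ 2 = p x ^+ 2.
  by rewrite -ps normc_sqr/= expr0n/= addr0.
have ip : leb.-integrable setT (fun x => (p x ^+ 2 * gaussn 2^-1 0 x ^+ 2)%:E).
  by have := P_sqr_integrable s; under eq_fun do rewrite pE.
have gr : \int[leb]_x (Normc.normc (Phi x) ^+ 2) =
    \int[leb]_x (p x ^+ 2 * gaussn 2^-1 0 x ^+ 2).
  by rewrite gram; apply: eq_Rintegral => x _; rewrite pE.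
(* p times the Gaussian is the Fourier transform of [Phi] divided by [gcst]; expanding both sides
   over [s] lets the duality [wG] act term by term. *)
have wpE x : w x * ((p x * gaussn 2^-1 0 x)%:C)%C =
    \sum_(z <- s) (z.1 * ((gcst^-1)%:C)%C) * (w x * fourier (gphi (- z.2)) x).
  have -> : ((p x * gaussn 2^-1 0 x)%:C = (p x)%:C * (gaussn 2^-1 0 x)%:C)%C by exact: rmorphM.
  rewrite ps mulr_suml mulr_sumr; apply: eq_bigr => z _.
  rewrite fourier_gphi dotNr opprK dotC.
  apply: complex_eqP; rewrite !(ReM, ImM) /=; field; exact: lt0r_neq0.
have GPE x : ((gcst^-1)%:C)%C * (G x * Phi x) =
    \sum_(z <- s) (z.1 * ((gcst^-1)%:C)%C) * (G x * gphi (- z.2) x).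
  by rewrite /Phi !mulr_sumr; apply: eq_bigr => z _; ring.
have X : cintegral (fun x => w x * ((p x * gaussn 2^-1 0 x)%:C)%C) =
    cintegral (fun x => ((gcst^-1)%:C)%C * (G x * Phi x)).
  under eq_fun do rewrite wpE; under [in RHS]eq_fun do rewrite GPE.
  rewrite !cintegral_sum; [|by move=> z; exact: cintegrableZ..].
  by apply: eq_bigr => z _; rewrite !cintegralZ// wG.
have [iwp _] : cintegrable (fun x => w x * ((p x * gaussn 2^-1 0 x)%:C)%C).
  by under eq_fun do rewrite wpE; apply: cintegrable_sum => z; exact: cintegrableZ.
have [iGP _] : cintegrable (fun x => ((gcst^-1)%:C)%C * (G x * Phi x)).
  by under eq_fun do rewrite GPE; apply: cintegrable_sum => z; exact: cintegrableZ.
have uE x : 2 * Re (w x) * p x * gaussn 2^-1 0 x - p x ^+ 2 * gaussn 2^-1 0 x ^+ 2 =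
    2 * Re (w x * ((p x * gaussn 2^-1 0 x)%:C)%C) - p x ^+ 2 * gaussn 2^-1 0 x ^+ 2.
  by rewrite ReM/= mulr0 subr0 !mulrA.
under eq_Rintegral do rewrite uE.
rewrite RintegralB//; last exact: RintegrableZ.
rewrite RintegralZl//.
have -> : \int[leb]_x Re (w x * ((p x * gaussn 2^-1 0 x)%:C)%C) =
    \int[leb]_x Re (((gcst^-1)%:C)%C * (G x * Phi x)) by have [] := X.
rewrite -RintegralZl// -gr lerBlDr.
have iPhi := Phi_sqr_integrable s.
(* Pointwise this is the nonnegativity of |e G - conj Phi|^2 with e = 1 / [gcst]. *)
apply: (@le_trans _ _ (\int[leb]_x (gcst ^- 2 * Normc.normc (G x) ^+ 2 + Normc.normc (Phi x) ^+ 2))).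
  apply: le_Rintegral => //.
  - exact: RintegrableZ.
  - by apply: RintegrableD => //; exact: RintegrableZ.
  - move=> x _; rewrite !normc_sqr !ReM ImM/= mul0r subr0 -(exprVn gcst 2).
    move: (Re (G x)) (Im (G x)) (Re (Phi x)) (Im (Phi x)) (gcst^-1) => a b c d e.
    rewrite -subr_ge0 [X in 0 <= X](_ : _ = (e * a - c) ^+ 2 + (e * b + d) ^+ 2).
      by rewrite addr_ge0 ?sqr_ge0.
    by ring.
rewrite RintegralD//; last exact: RintegrableZ.
rewrite RintegralZl// lerD2r ler_wpM2l//; first by rewrite invr_ge0 exprn_ge0// ltW.
rewrite -lee_fin /Rintegral fineK//; exact: integrable_fin_num.
Qed.

End plancherel.

(** * Almost everywhere convergence *)

Section convergence.
Set Implicit Arguments.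
Unset Strict Implicit.
Variable R : realType.
Local Notation Re := complex.Re.
Local Notation Im := complex.Im.

Lemma sqr_sin_le (x : R) : 0 <= x -> sin x ^+ 2 <= x ^+ 2.
Proof.
move=> x0; have [c _] := @MVT_segment R sin cos 0 x x0
  (fun y _ => is_derive_sin y) (continuous_subspaceT (@continuous_sin R)).
by rewrite sin0 !subr0 => ->; rewrite exprMn ler_piMl ?sqr_ge0.
Qed.

(** The left side is 4 sin^2 (t/2). For t <= 1 the squared sine is at most t^2 <= t^q, using q <= 2;
    for t >= 1 it is at most 1 <= t^q. *)
Lemma normc_expiB1_le (t q : R) : 0 <= t -> 0 < q <= 2 ->
  Normc.normc (expi t - 1) ^+ 2 <= 4 * t `^ q.
Proof.
move=> t0 /andP[q0 q2].
have E : Normc.normc (expi t - 1) ^+ 2 = 4 * sin (t / 2) ^+ 2.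
  rewrite normc_sqr !(ReD, ImD, ReN, ImN)/= subr0.
  have h1 := cos2Dsin2 (t / 2).
  have := cosD (t / 2) (t / 2); rewrite -splitr => ->.
  have := sinD (t / 2) (t / 2); rewrite -splitr => ->.
  move: (cos (t / 2)) (sin (t / 2)) h1 => c s h1.
  have -> : c * c = 1 - s * s by rewrite -!expr2 -h1; ring.
  have -> : (s * c + c * s) ^+ 2 = 4 * s ^+ 2 * c ^+ 2 by ring.
  by have -> : c ^+ 2 = 1 - s ^+ 2 by [rewrite -h1; ring]; ring.
rewrite E ler_pM2l//.
have [->|tn0] := eqVneq t 0; first by rewrite mul0r sin0 expr0n/= powR_ge0.
have tp : 0 < t by rewrite lt_neqAle eq_sym tn0.
have [t1|/ltW t1] := leP t 1; last first.
  apply: (@le_trans _ _ 1); first by rewrite -[leRHS](cos2Dsin2 (t / 2)) lerDr sqr_ge0.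
  by rewrite -(powRr0 t) ler_powR// ltW.
apply: (@le_trans _ _ (t ^+ 2)).
  apply: (le_trans (sqr_sin_le _)); first by rewrite divr_ge0.
  by rewrite lerXn2r ?nnegrE ?divr_ge0// ler_pdivrMr// ler_peMr// ler1n.
by rewrite -powR_mulrn//; apply: ger_powR => //; rewrite tp t1.
Qed.

Lemma sqr_summable_cvg0 (u : nat -> R) :
  (\sum_(0 <= k <oo) (u k ^+ 2)%:E < +oo)%E -> u k @[k --> \oo] --> 0.
Proof.
move=> us.
have u0 k : (0 <= (u k ^+ 2)%:E)%E by rewrite lee_fin sqr_ge0.
have tl := nneseries_tail_cvg us (fun k _ => u0 k).
have sq : (u k ^+ 2)%:E @[k --> \oo] --> 0%E.
  apply: (squeeze_cvge _ (cvg_cst 0%E) tl).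
  (* The k-th term is at most the tail starting at k, which tends to 0. *)
  apply: nearW => k; rewrite u0/=.
  have := @nneseries_lim_ge R (fun k => (u k ^+ 2)%:E) xpredT k k.+1 (fun i _ _ => u0 i).
  by rewrite big_nat1.
apply/cvgr0Pnorm_lt => e e0.
have sq' : u k ^+ 2 @[k --> \oo] --> (0 : R) by exact: (fine_cvg sq).
move/cvgr0Pnorm_lt : sq' => /(_ _ (exprn_gt0 2 e0)).
apply: filterS => k /=; rewrite ger0_norm ?sqr_ge0//.
by rewrite -[u k ^+ 2]real_normK ?num_real// ltr_pXn2r ?nnegrE// ltW.
Qed.

Lemma complex_cvg (v : nat -> R[i]) (l : R[i]) :
  Re (v k - l) @[k --> \oo] --> (0 : R) -> Im (v k - l) @[k --> \oo] --> (0 : R) ->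
  ((v k : R[i]^o) @[k --> \oo] --> (l : R[i]^o)).
Proof.
move=> hr hi; apply/cvgrPdist_lt => e.
(* The radius [e] is itself complex; its positivity says that it is real with positive real part. *)
rewrite ltcE => /andP[/eqP Ie Re0]; rewrite /= in Ie Re0.
have e20 : 0 < Re e / 2 by rewrite divr_gt0.
near=> k; rewrite distrC ltcE normc_def /= Ie eqxx/=.
have h1 : `|Re (v k - l)| < Re e / 2.
  by near: k; move/cvgr0Pnorm_lt : hr => /(_ _ e20).
have h2 : `|Im (v k - l)| < Re e / 2.
  by near: k; move/cvgr0Pnorm_lt : hi => /(_ _ e20).
have := normc_le_ReIm (v k - l); set z := v k - l in h1 h2 *.
by case: z h1 h2 => a b /= h1 h2; lra.
Unshelve. all: end_near. Qed.

Variable n : nat.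
Local Notation V := ('rV[R]_n).
Local Notation leb := (@lebesgue_rV R n).

Lemma ae_cvg0 (u : nat -> V -> R) (c : nat -> R) :
  (forall k, measurable_fun setT (u k)) ->
  (forall k, (\int[leb]_x (u k x ^+ 2)%:E <= (c k)%:E)%E) ->
  (\sum_(0 <= k <oo) (c k)%:E < +oo)%E ->
  {ae leb, forall x, u k x @[k --> \oo] --> 0}.
Proof.
move=> mu uc cs.
have mu2 k : measurable_fun setT (fun x => (u k x ^+ 2)%:E).
  by apply/measurable_EFinP; exact: measurable_funX.
have u0 k x : (0 <= (u k x ^+ 2)%:E)%E by rewrite lee_fin sqr_ge0.
have S : (\int[leb]_x (\sum_(0 <= k <oo) (u k x ^+ 2)%:E) < +oo)%E.
  rewrite integral_nneseries//; apply: le_lt_trans cs.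
  by apply: lee_nneseries => // k _ _; exact: integral_ge0.
have iS : leb.-integrable setT (fun x => \sum_(0 <= k <oo) (u k x ^+ 2)%:E)%E.
  apply/integrableP; split; first exact: ge0_emeasurable_sum.
  under eq_integral do rewrite gee0_abs ?nneseries_ge0//.
  exact: S.
have := integrable_ae measurableT iS.
apply: filterS => x /(_ I) xf; apply: sqr_summable_cvg0.
by rewrite -ge0_fin_numE// nneseries_ge0.
Qed.

Lemma cmeasurableB (f g : V -> R[i]) : cmeasurable f -> cmeasurable g ->
  cmeasurable (fun x => f x - g x).
Proof.
move=> [f1 f2] [g1 g2]; split.
  under eq_fun do rewrite ReD ReN; exact: measurable_funB.
under eq_fun do rewrite ImD ImN; exact: measurable_funB.
Qed.

Lemma cmeasurableM (f g : V -> R[i]) : cmeasurable f -> cmeasurable g ->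
  cmeasurable (fun x => f x * g x).
Proof.
move=> [f1 f2] [g1 g2]; split.
  under eq_fun do rewrite ReM; apply: measurable_funB; exact: measurable_funM.
under eq_fun do rewrite ImM; apply: measurable_funD; exact: measurable_funM.
Qed.

(** Im w is the real part of -i w, and multiplying both [w] and [G] by the unimodular constant -i,
    here named [i], preserves every hypothesis. *)
Lemma plancherel_Im (w G : V -> R[i]) (K : R) : cmeasurable w -> cmeasurable G ->
  (forall m, cintegrable (fun x => w x * fourier (gphi m) x)) ->
  (forall m, cintegrable (fun x => G x * gphi m x)) ->
  (forall m, cintegral (fun x => w x * fourier (gphi m) x) =
             cintegral (fun x => G x * gphi m x)) ->
  (\int[leb]_x (Normc.normc (G x) ^+ 2)%:E <= K%:E)%E ->
  (\int[leb]_x (Im (w x) ^+ 2)%:E <= (gcst R n ^- 2 * K)%:E)%E.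
Proof.
move=> mw mG wi Gi wG GK; pose i : R[i] := (0 -i* 1)%C.
have mi : cmeasurable (fun _ : V => i) by split; exact: measurable_cst.
have -> : (\int[leb]_x (Im (w x) ^+ 2)%:E = \int[leb]_x (Re (i * w x) ^+ 2)%:E)%E.
  by apply: eq_integral => x _; rewrite ReM/= mul0r sub0r mulN1r opprK.
apply: (@plancherel_Re R n (fun x => i * w x) (fun x => i * G x)).
- exact: cmeasurableM.
- exact: cmeasurableM.
- by move=> m; under eq_fun do rewrite -mulrA; exact: cintegrableZ.
- by move=> m; under eq_fun do rewrite -mulrA; exact: cintegrableZ.
- move=> m; under eq_fun do rewrite -mulrA; under [in RHS]eq_fun do rewrite -mulrA.
  by rewrite !cintegralZ// wG.
- apply: le_trans GK; under eq_integral do rewrite Normc.normcM exprMn (normc_sqr i)/=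
    expr0n/= add0r sqrrN expr1n mul1r.
  exact: lexx.
Qed.

Lemma represents_gphi (T : (V -> R[i]) -> R[i]) F m : represents (fourier_distr T) F ->
  cintegrable (fun x => F x * gphi m x) /\
  T (fourier (gphi m)) = cintegral (fun x => F x * gphi m x).
Proof. by move=> [_ /(_ _ (schwartz_gphi m))]. Qed.

Lemma represents_fourier_gphi (T : (V -> R[i]) -> R[i]) f m : represents T f ->
  cintegrable (fun x => f x * fourier (gphi m) x) /\
  T (fourier (gphi m)) = cintegral (fun x => f x * fourier (gphi m) x).
Proof. by move=> [_ /(_ _ (schwartz_fourier_gphi m))]. Qed.

Lemma ae_eq0_sqr (u : V -> R) : measurable_fun setT u ->
  (\int[leb]_x (u x ^+ 2)%:E <= 0)%E -> {ae leb, forall x, u x = 0}.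
Proof.
move=> mu u0.
have mu2 : measurable_fun setT (fun x => (u x ^+ 2)%:E).
  by apply/measurable_EFinP; exact: measurable_funX.
have /(ae_eq_integral_abs _ measurableT mu2) : (\int[leb]_x `|(u x ^+ 2)%:E| = 0)%E.
  apply/eqP; rewrite eq_le; apply/andP; split; last exact: integral_ge0.
  by under eq_integral do rewrite gee0_abs ?lee_fin ?sqr_ge0//.
apply: filterS => x /(_ I) /= [] /eqP.
by rewrite sqrf_eq0 => /eqP.
Qed.

(* The case [G = 0] of the Plancherel inequality. *)
Lemma represents_unique (T : (V -> R[i]) -> R[i]) F F' :
  represents T F -> represents T F' -> {ae leb, forall x, F x = F' x}.
Proof.
move=> rF rF'; pose w x := F x - F' x.
have mw : cmeasurable w by apply: cmeasurableB; [exact: rF.1|exact: rF'.1].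
have m0 : cmeasurable (fun _ : V => (0 : R[i])) by split; exact: measurable_cst.
have wE m x : w x * fourier (gphi m) x =
    F x * fourier (gphi m) x - F' x * fourier (gphi m) x by rewrite mulrBl.
have wi m : cintegrable (fun x => w x * fourier (gphi m) x).
  under eq_fun do rewrite wE; apply: cintegrableB.
    by have [] := represents_fourier_gphi m rF.
  by have [] := represents_fourier_gphi m rF'.
have Gi m : cintegrable (fun x : V => 0 * gphi m x).
  by under eq_fun do rewrite mul0r; exact: cintegrable0.
have wG m : cintegral (fun x => w x * fourier (gphi m) x) = cintegral (fun x => 0 * gphi m x).
  under eq_fun do rewrite wE; under [in RHS]eq_fun do rewrite mul0r.
  have [i1 e1] := represents_fourier_gphi m rF.
  have [i2 e2] := represents_fourier_gphi m rF'.
  by rewrite cintegralB// -e1 -e2 subrr cintegral0.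
have GK : (\int[leb]_x (Normc.normc (0 : R[i]) ^+ 2)%:E <= 0%:E)%E.
  under eq_integral do rewrite normc_sqr/= expr0n/= addr0.
  by rewrite integral0.
have hR := plancherel_Re mw m0 wi Gi wG GK.
have hI := plancherel_Im mw m0 wi Gi wG GK.
rewrite mulr0 in hR hI.
have := ae_eq0_sqr mw.2 hI; have := ae_eq0_sqr mw.1 hR.
apply: filterS2 => x; rewrite /w ReD ReN ImD ImN => h1 h2.
by apply: complex_eqP; apply/eqP; rewrite -subr_eq0; apply/eqP.
Qed.

Lemma memL2_test v m : memL2 v -> cintegrable (fun x : V => v x * fourier (gphi m) x).
Proof.
move=> [mv vL2]; have g0 := gcst_gt0 R n.
have mF : cmeasurable (fourier (gphi m) : V -> R[i]).
  have mc (h : R -> R) : measurable_fun setT h ->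
      measurable_fun setT (fun x : V => gcst R n * gaussn 2^-1 0 x * h (- dot x m)).
    move=> mh; apply: measurable_funM.
      by apply: measurable_funM => //; exact: measurable_gaussn.
    apply: (measurableT_comp mh); under eq_fun do rewrite dotC.
    by apply: measurableT_comp => //; exact: measurable_dot.
  rewrite fourier_gphi; split.
    rewrite (_ : (fun x => _) = fun x : V => gcst R n * gaussn 2^-1 0 x * cos (- dot x m)).
      exact: mc (@measurable_cosR R).
    by apply/funext => x; rewrite ReM/= mul0r subr0.
  rewrite (_ : (fun x => _) = fun x : V => gcst R n * gaussn 2^-1 0 x * sin (- dot x m)).
    exact: mc (@measurable_sinR R).
  by apply/funext => x; rewrite ImM/= mul0r addr0.
have iv : leb.-integrable setT (fun x => (Normc.normc (v x) ^+ 2)%:E).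
  apply/integrableP; split.
    by apply/measurable_EFinP; exact: measurable_normc_sqr.
  by under eq_integral do rewrite gee0_abs ?lee_fin ?sqr_ge0//.
have ib : leb.-integrable setT
    (fun x => (Normc.normc (v x) ^+ 2 + gcst R n ^+ 2 * gaussn 1 0 x)%:E).
  by apply: RintegrableD => //; apply: RintegrableZ; exact: gaussn_integrable.
have bnd x : Normc.normc (v x * fourier (gphi m) x) <=
    Normc.normc (v x) ^+ 2 + gcst R n ^+ 2 * gaussn 1 0 x.
  rewrite Normc.normcM fourier_gphi Normc.normcM normc_expi mulr1 -gaussn_sqr -exprMn.
  have -> : Normc.normc ((gcst R n * gaussn 2^-1 0 x)%:C)%C = gcst R n * gaussn 2^-1 0 x.
    by rewrite /= expr0n/= addr0 sqrtr_sqr ger0_norm// mulr_ge0 ?gaussn_ge0// ltW.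
  have : 0 <= gcst R n * gaussn 2^-1 0 x by rewrite mulr_ge0 ?gaussn_ge0// ltW.
  move: (gcst R n * _) (Normc.normc _) (normc_ge0 (v x)) => b a a0 b0; nra.
have [m1 m2] := cmeasurableM mv mF.
split; apply: Rintegrable_le ib => // x; apply: le_trans (bnd x).
  exact: Re_le_normc.
exact: Im_le_normc.
Qed.

Lemma measurable_dotxx : measurable_fun setT (fun x : V => dot x x).
Proof.
by apply: measurable_sum => i; apply: measurable_funM; exact: measurable_coord.
Qed.

Lemma measurable_enorm : measurable_fun setT (@enorm R n).
Proof.
rewrite (_ : @enorm R n = fun x => dot x x `^ 2^-1); last first.
  by apply/funext => x; rewrite powR12_sqrt// dotxx_ge0.
exact: measurableT_comp (@measurable_powR R 2^-1) measurable_dotxx.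
Qed.

Lemma cmeasurable_multiplier (a t : R) :
  cmeasurable (fun x : V => expi (t * enorm x `^ a) - 1).
Proof.
have mt : measurable_fun setT (fun x : V => t * enorm x `^ a).
  apply: measurable_funM => //.
  exact: (measurableT_comp (@measurable_powR R a) measurable_enorm).
have m1 : cmeasurable (fun _ : V => (1 : R[i])) by split; exact: measurable_cst.
apply: (cmeasurableB _ m1); split; first exact: measurableT_comp (@measurable_cosR R) mt.
exact: measurableT_comp (@measurable_sinR R) mt.
Qed.

(** With q = 2s/a, (t |xi|^a)^q = t^q |xi|^(2s), and |xi|^(2s) <= (1 + |xi|^2)^s. *)
Lemma multiplier_bound (s a t : R) (F : V -> R[i]) (N : R) :
  0 < s -> s <= a -> 0 <= t -> cmeasurable F ->
  (\int[leb]_x ((1 + enorm x ^+ 2) `^ s * Normc.normc (F x) ^+ 2)%:E = N%:E)%E ->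
  (\int[leb]_x (Normc.normc ((expi (t * enorm x `^ a) - 1) * F x) ^+ 2)%:E <=
    (4 * t `^ (2 * s / a) * N)%:E)%E.
Proof.
move=> s0 sa t0 mF FN.
have a0 : 0 < a by exact: lt_le_trans sa.
have mW : measurable_fun setT
    (fun x => ((1 + enorm x ^+ 2) `^ s * Normc.normc (F x) ^+ 2)%:E).
  apply/measurable_EFinP; apply: measurable_funM; last exact: measurable_normc_sqr.
  apply: (measurableT_comp (@measurable_powR R s)).
  by apply: measurable_funD => //; apply: measurable_funX; exact: measurable_enorm.
have mE := cmeasurableM (cmeasurable_multiplier a t) mF.
rewrite EFinM -FN -ge0_integralZl//; last 2 first.
  by move=> x _; rewrite lee_fin mulr_ge0 ?powR_ge0 ?sqr_ge0.
  by rewrite lee_fin mulr_ge0 ?powR_ge0.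
apply: ge0_le_integral => //.
- by move=> x _; rewrite lee_fin sqr_ge0.
- by apply/measurable_EFinP; exact: (measurable_normc_sqr mE).
- exact: (measurable_funeM (4 * t `^ (2 * s / a))%:E mW).
- move=> x _; rewrite -EFinM lee_fin Normc.normcM exprMn [leRHS]mulrA ler_wpM2r ?sqr_ge0//.
  have e0 : 0 <= enorm x by exact: sqrtr_ge0.
  (* The upper bound is the hypothesis s <= a. *)
  have q : 0 < 2 * s / a <= 2.
    by rewrite divr_gt0 ?mulr_gt0//= ler_pdivrMr// ler_pM2l.
  apply: le_trans (normc_expiB1_le _ q) _; first by rewrite mulr_ge0 ?powR_ge0.
  rewrite powRM ?powR_ge0// -[leRHS]mulrA ler_pM2l// ler_wpM2l ?powR_ge0//.
  rewrite -powRrM (_ : a * (2 * s / a) = 2 * s); last by field; rewrite gt_eqF.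
  rewrite powRrM powR_mulrn//; apply: ge0_ler_powR; first exact: ltW.
  - by rewrite nnegrE sqr_ge0.
  - by rewrite nnegrE addr_ge0// sqr_ge0.
  - by rewrite lerDr.
Qed.

(** Stated with one [F] fixed outside [is_S], so that [N] is the same for all times and the bounds
    can be summed. *)
Lemma is_S_sqr_le (s a t : R) T f u F (N : R) : 0 < s -> s <= a -> 0 <= t ->
  represents T f -> represents (fourier_distr T) F ->
  (\int[leb]_x ((1 + enorm x ^+ 2) `^ s * Normc.normc (F x) ^+ 2)%:E = N%:E)%E ->
  is_S t a T u ->
  let w x := ((2 * pi) ^- n)%:C%C * u x - f x in
  [/\ cmeasurable w,
   (\int[leb]_x (Re (w x) ^+ 2)%:E <= (gcst R n ^- 2 * (4 * t `^ (2 * s / a) * N))%:E)%E &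
   (\int[leb]_x (Im (w x) ^+ 2)%:E <= (gcst R n ^- 2 * (4 * t `^ (2 * s / a) * N))%:E)%E].
Proof.
move=> s0 sa t0 rf rF FN [vL2 [F' rF' rv]] w.
set v := fun x => ((2 * pi) ^- n)%:C%C * u x in vL2 rv.
pose G x := expi (t * enorm x `^ a) * F' x - F' x.
have mw : cmeasurable w by apply: cmeasurableB; [exact: vL2.1|exact: rf.1].
have mG : cmeasurable G by apply: cmeasurableB; [exact: rv.1|exact: rF'.1].
have wE m x : w x * fourier (gphi m) x =
  v x * fourier (gphi m) x - f x * fourier (gphi m) x by rewrite mulrBl.
have GE m x : G x * gphi m x =
  expi (t * enorm x `^ a) * F' x * gphi m x - F' x * gphi m x by rewrite mulrBl.
have iv m := memL2_test m vL2.
have wi m : cintegrable (fun x => w x * fourier (gphi m) x).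
  under eq_fun do rewrite wE; apply: cintegrableB => //.
  by have [] := represents_fourier_gphi m rf.
have Gi m : cintegrable (fun x => G x * gphi m x).
  under eq_fun do rewrite GE; apply: cintegrableB.
    by have [] := represents_gphi m rv.
  by have [] := represents_gphi m rF'.
have wG m : cintegral (fun x => w x * fourier (gphi m) x) =
    cintegral (fun x => G x * gphi m x).
  under eq_fun do rewrite wE; under [in RHS]eq_fun do rewrite GE.
  have [i1 e1] := represents_fourier_gphi m rf.
  have [i2 e2] := represents_gphi m rv.
  have [i3 e3] := represents_gphi m rF'.
  by rewrite !cintegralB// -e1 -e2 -e3.
have GK : (\int[leb]_x (Normc.normc (G x) ^+ 2)%:E <= (4 * t `^ (2 * s / a) * N)%:E)%E.
  (* [G] is built on the version [F'] contained in [is_S]; it agrees almost everywhere with the one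
     built on [F], so the integrals compare. *)
  apply: le_trans (multiplier_bound s0 sa t0 rF.1 FN).
  have mE := cmeasurableM (cmeasurable_multiplier a t) rF.1.
  apply: ae_ge0_le_integral => //.
  - by move=> x _; rewrite lee_fin sqr_ge0.
  - by apply/measurable_EFinP; exact: measurable_normc_sqr.
  - by move=> x _; rewrite lee_fin sqr_ge0.
  - by apply/measurable_EFinP; exact: measurable_normc_sqr.
  - have := represents_unique rF rF'.
    by apply: filterS => x -> _; rewrite mulrBl mul1r.
split => //; first exact: (plancherel_Re mw mG wi Gi wG GK).
exact: (plancherel_Im mw mG wi Gi wG GK).
Qed.

End convergence.

Theorem theorem1p2 (R : realType) (n : nat) (s a : R)
    (T : ('rV[R]_n -> R[i]) -> R[i]) (f : 'rV[R]_n -> R[i])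
    (t : nat -> R) (Sf : nat -> 'rV[R]_n -> R[i]) :
  (1 <= n)%N ->
  0 < s -> s <= a -> a <= 1 ->
  sobolev s T -> represents T f ->
  (forall k, 0 <= t k) ->
  t @ \oo --> (0 : R) ->
  (\sum_(0 <= k <oo) (t k `^ (2 * s / a))%:E < +oo)%E ->
  (forall k, is_S (t k) a T (Sf k)) ->
  {ae @lebesgue_rV R n, forall x,
    (((2 * pi) ^- n)%:C%C * Sf k x : R[i]^o) @[k --> \oo] --> (f x : R[i]^o)}.
Proof.
move=> _ s0 sa _ [_ [F rF FH]] rf t0 _ ts hS.
have I0 : (0 <= \int[@lebesgue_rV R n]_x
    ((1 + enorm x ^+ 2) `^ s * Normc.normc (F x) ^+ 2)%:E)%E.
  by apply: integral_ge0 => x _; rewrite lee_fin mulr_ge0 ?powR_ge0 ?sqr_ge0.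
have [N FN] : exists N : R, (\int[@lebesgue_rV R n]_x
    ((1 + enorm x ^+ 2) `^ s * Normc.normc (F x) ^+ 2)%:E = N%:E)%E.
  eexists; rewrite -[LHS]fineK// ge0_fin_numE//.
  by apply: lty_poweRy FH; rewrite invr_eq0 pnatr_eq0.
have N0 : 0 <= N by rewrite -lee_fin -FN.
(* The same summable sequence bounds the real and the imaginary parts, which are treated separately
   and recombined at the end. *)
pose c k := gcst R n ^- 2 * (4 * t k `^ (2 * s / a) * N).
have cs : (\sum_(0 <= k <oo) (c k)%:E < +oo)%E.
  have cE k : (c k)%:E = ((gcst R n ^- 2 * (4 * N))%:E * (t k `^ (2 * s / a))%:E)%E.
    by rewrite -EFinM /c; congr EFin; ring.
  under eq_eseriesr do rewrite cE.
  rewrite nneseriesZl; last by move=> k _; rewrite lee_fin powR_ge0.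
  rewrite lte_mul_pinfty//.
  by rewrite lee_fin mulr_ge0 ?mulr_ge0// invr_ge0 exprn_ge0// ltW// gcst_gt0.
have H k := is_S_sqr_le s0 sa (t0 k) rf rF FN (hS k).
have mr k := let: And3 m _ _ := H k in m.1.
have mi k := let: And3 m _ _ := H k in m.2.
have hr k := let: And3 _ h _ := H k in h.
have hi k := let: And3 _ _ h := H k in h.
have := ae_cvg0 mi hi cs; have := ae_cvg0 mr hr cs.
by apply: filterS2 => x h1 h2; exact: complex_cvg.
Qed.
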